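(* Let $\mathcal{A}$ be a (not necessarily commutative) $\mathfrak{g}$-differential algebra with connection $\theta$. Then the symmetrization (characteristic) map $c^\theta: W\mathfrak{g}\to\mathcal{A}$ is a homomorphism of $\mathfrak{g}$-differential spaces. The induced map in basic cohomology $(S\mathfrak{g}^* )_{\mathrm{inv}}=H((W\mathfrak{g})_{\mathrm{basic}})\to H(\mathcal{A}_{\mathrm{basic}})$ is independent of the choice of the connection $\theta$ on $\mathcal{A}$, and is an algebra homomorphism.
   Context: $\mathbb{F}$ is a field of characteristic $0$, $\mathfrak{g}$ a finite-dimensional Lie algebra over $\mathbb{F}$. ''Super'' means $\mathbb{Z}_2$-graded with the usual sign rule; super algebras are associative and unital; $[\cdot,\cdot]$ denotes the super commutator of operators. A $\mathfrak{g}$-differential space is a super vector space $E$ with an odd operator $d$, $d^2=0$, and, depending linearly on $\xi\in\mathfrak{g}$, odd operators $\iota_\xi$ and even operators $L_\xi$ such that $[\iota_\xi,\iota_\zeta]=0$, $[L_\xi,\iota_\zeta]=\iota_{[\xi,\zeta]}$, $[L_\xi,L_\zeta]=L_{[\xi,\zeta]}$, $[d,\iota_\xi]=L_\xi$, $[d,L_\xi]=0$. Homomorphisms of $\mathfrak{g}$-differential spaces are even linear maps commuting with $d,\iota_\xi,L_\xi$. A $\mathfrak{g}$-differential algebra is a super algebra that is a $\mathfrak{g}$-differential space for which $d,\iota_\xi,L_\xi$ are super derivations. $E_{\mathrm{basic}}=\bigcap_\xi(\ker\iota_\xi\cap\ker L_\xi)$ is a subcomplex for $d$. For $\mu\in\mathfrak{g}^*$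 let $(\mathrm{ad}_\xi^*\mu)(\zeta)=\mu([\xi,\zeta])$. A connection on $\mathcal{A}$ is a linear map $\theta:\mathfrak{g}^*\to\mathcal{A}^{\bar 1}$ (odd part) with $\iota_\xi\theta(\mu)=\mu(\xi)1$ and $L_\xi\theta(\mu)=-\theta(\mathrm{ad}^*_\xi\mu)$. The Weil algebra $W\mathfrak{g}$ is the free super-commutative algebra generated by odd elements $\mu$ and even elements $\overline{\mu}$ (linear in $\mu\in\mathfrak{g}^*$), with derivations determined by $d\mu=\overline\mu$, $d\overline\mu=0$, $L_\xi\mu=-\mathrm{ad}_\xi^*\mu$, $L_\xi\overline\mu=-\overline{\mathrm{ad}_\xi^*\mu}$, $\iota_\xi\mu=\mu(\xi)$, $\iota_\xi\overline\mu=-\mathrm{ad}_\xi^*\mu$. Let $\lambda:\mathfrak{g}^*\to\wedge^2\mathfrak{g}^*$ be given by $\iota_\xi\lambda(\mu)=-\mathrm{ad}_\xi^*\mu$, where $\wedge\mathfrak{g}^*\subset W\mathfrak{g}$ is generated by the odd generators, and put $\widehat\mu=\overline\mu-\lambda(\mu)$. The elements $\widehat\mu$ generate a copy of $S\mathfrak{g}^*$ in $W\mathfrak{g}$, equal to $\bigcap_\xi\ker\iota_\xi$, and $(W\mathfrak{g})_{\mathrm{basic}}=(S\mathfrak{g}^* )_{\mathrm{inv}}$, on which $d$ vanishes. The map $c^\theta:W\mathfrak{g}\to\mathcal{A}$ is defined by super symmetrization: with $\phi(\mu)=\theta(\mu)$, $\phi(\overline\mu)=d\theta(\mu)$, and generators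 $v_1,\dots,v_k$ of $W\mathfrak{g}$, each of the form $\mu$ (odd) or $\overline\mu$ (even) for some $\mu\in\mathfrak{g}^*$, $$c^\theta(v_1\cdots v_k)=\frac1{k!}\sum_{\sigma\in\mathfrak{S}_k}(-1)^{N_\sigma}\phi(v_{\sigma^{-1}(1)})\cdots\phi(v_{\sigma^{-1}(k)}),$$ where $N_\sigma$ is the number of pairs $i<j$ with $v_i,v_j$ odd and $\sigma^{-1}(i)>\sigma^{-1}(j)$; $c^\theta(1)=1$.
   Formalization: The sign exponent N_σ is corrected to the Koszul sign: it counts pairs i<j with v_{σ^{-1}(i)}, v_{σ^{-1}(j)} odd and σ^{-1}(i)>σ^{-1}(j); with parity tested on v_i, v_j as printed, c^θ is ill-defined on words mixing odd and even generators. *)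

(* Defs.v *)
From HB Require Import structures.
From mathcomp Require Import all_boot all_algebra perm.
From mathcomp Require Import boolp.

Set Implicit Arguments.
Unset Strict Implicit.
Unset Printing Implicit Defensive.

Import GRing.Theory.
Local Open Scope ring_scope.
Local Open Scope quotient_scope.

Record lieAlgebra (F : fieldType) := LieAlgebra {
  lie_sort :> vectType F;
  bracket : lie_sort -> lie_sort -> lie_sort;
  bracket_linear_l : forall y, linear (bracket^~ y);
  bracket_linear_r : forall x, linear (bracket x);
  bracket_alternating : forall x, bracket x x = 0;
  bracket_jacobi : forall x y z,
    bracket x (bracket y z) + bracket y (bracket z x)
      + bracket z (bracket x y) = 0
}.

Definition dual (F : fieldType) (g : lieAlgebra F) : vectType F :=
  'Hom(g, F^o).

Section Coadjoint.
Variables (F : fieldType) (g : lieAlgebra F).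

Definition coad (xi : g) (mu : dual g) : dual g :=
  linfun (fun zeta : g => (mu : 'Hom(g, F^o)) (bracket xi zeta)).

Lemma coadE (xi : g) (mu : dual g) (zeta : g) :
  (coad xi mu : 'Hom(g, F^o)) zeta = (mu : 'Hom(g, F^o)) (bracket xi zeta).
Proof.
pose f (z : g) : F^o := (mu : 'Hom(g, F^o)) (bracket xi z).
have lf : linear f by move=> a x y; rewrite /f bracket_linear_r linearP.
pose fL := GRing.isLinear.Build F g F^o _ f lf.
pose fM : {linear g -> F^o} := HB.pack f fL.
exact: (lfunE fM).
Qed.

End Coadjoint.

(* A Z/2-grading; the index [true] is the odd degree. *)
Record grading (F : fieldType) (E : lmodType F) := Grading {
  homog : bool -> E -> Prop;
  homog0 : forall i, homog i 0;
  homog_linear : forall i a x y,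
    homog i x -> homog i y -> homog i (a *: x + y);
  homog_decomp : forall x, exists x0 x1,
    [/\ homog false x0, homog true x1 & x = x0 + x1];
  homog_disjoint : forall x, homog false x -> homog true x -> x = 0
}.

Arguments homog0 {F E}.
Arguments homog_disjoint {F E} _ [x].

Section Super.
Variables (F : fieldType) (E : lmodType F) (G : grading E).

Definition op_parity (p : bool) (P : E -> E) :=
  forall i x, homog G i x -> homog G (p (+) i) (P x).

(* The super commutator of operators of parities p and q. *)
Definition scomm (p q : bool) (P Q : E -> E) (x : E) : E :=
  P (Q x) - (-1) ^+ (p && q) *: Q (P x).

End Super.

Section SuperAlgebra.
Variables (F : fieldType) (A : algType F) (G : grading A).

Definition super_algebra :=
  homog G false 1 /\
  forall i j x y, homog G i x -> homog G j y -> homog G (i (+) j) (x * y).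

Definition super_commutative :=
  forall i j x y, homog G i x -> homog G j y ->
    x * y = (-1) ^+ (i && j) *: (y * x).

Definition super_derivation (p : bool) (D : A -> A) :=
  forall i x y, homog G i x ->
    D (x * y) = D x * y + (-1) ^+ (p && i) *: (x * D y).

End SuperAlgebra.

Record gdSpace (F : fieldType) (g : lieAlgebra F) (E : lmodType F) := GdSpace {
  gds_grading :> grading E;
  dif : {linear E -> E};
  contr : g -> {linear E -> E};
  lie : g -> {linear E -> E};
  contr_linear : forall x, linear (fun xi => contr xi x);
  lie_linear : forall x, linear (fun xi => lie xi x);
  dif_parity : op_parity gds_grading true dif;
  contr_parity : forall xi, op_parity gds_grading true (contr xi);
  lie_parity : forall xi, op_parity gds_grading false (lie xi);
  dif_dif : forall x, dif (dif x) = 0;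
  contr_contr : forall xi zeta,
    scomm true true (contr xi) (contr zeta) =1 (fun=> 0);
  lie_contr : forall xi zeta,
    scomm false true (lie xi) (contr zeta) =1 contr (bracket xi zeta);
  lie_lie : forall xi zeta,
    scomm false false (lie xi) (lie zeta) =1 lie (bracket xi zeta);
  dif_contr : forall xi, scomm true true dif (contr xi) =1 lie xi;
  dif_lie : forall xi, scomm true false dif (lie xi) =1 (fun=> 0)
}.

Arguments dif_parity {F g E} _ _ [_].
Arguments contr_parity {F g E} _ _ _ [_].
Arguments lie_parity {F g E} _ _ _ [_].

Record gdAlgebra (F : fieldType) (g : lieAlgebra F) (A : algType F) :=
GdAlgebra {
  gda_space :> gdSpace g A;
  gda_super : super_algebra gda_space;
  dif_derivation : super_derivation gda_space true (dif gda_space);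
  contr_derivation : forall xi,
    super_derivation gda_space true (contr gda_space xi);
  lie_derivation : forall xi,
    super_derivation gda_space false (lie gda_space xi)
}.

Arguments gda_super {F g A}.
Arguments dif_derivation {F g A} _ [_].
Arguments contr_derivation {F g A} _ _ [_].
Arguments lie_derivation {F g A} _ _ [_].

Record gdsHom (F : fieldType) (g : lieAlgebra F) (E E' : lmodType F)
    (D : gdSpace g E) (D' : gdSpace g E') := GdsHom {
  gdsHom_fun :> {linear E -> E'};
  gdsHom_even : forall i x, homog D i x -> homog D' i (gdsHom_fun x);
  gdsHom_dif : forall x, gdsHom_fun (dif D x) = dif D' (gdsHom_fun x);
  gdsHom_contr : forall xi x,
    gdsHom_fun (contr D xi x) = contr D' xi (gdsHom_fun x);
  gdsHom_lie : forall xi x,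
    gdsHom_fun (lie D xi x) = lie D' xi (gdsHom_fun x)
}.

Section BasicCohomology.
Variables (F : fieldType) (g : lieAlgebra F) (E : lmodType F).
Variable D : gdSpace g E.

Definition basic (x : E) := forall xi : g, contr D xi x = 0 /\ lie D xi x = 0.

Lemma basic_dif x : basic x -> basic (dif D x).
Proof.
move=> bx xi; have [cx lx] := bx xi; split.
  have /= := dif_contr D xi x; rewrite /scomm cx lx linear0 /= expr1 scaleN1r.
  by rewrite opprK add0r.
have /= := dif_lie D xi x; rewrite /scomm lx linear0 /= expr0 scale1r.
by move/eqP; rewrite sub0r oppr_eq0 => /eqP.
Qed.

Definition basic_closed : {pred E} :=
  [pred x | `[< basic x /\ dif D x = 0 >]].

Lemma basic_closedP x : reflect (basic x /\ dif D x = 0) (x \in basic_closed).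
Proof. exact: asboolP. Qed.

Fact basic_closed_submod : submod_closed basic_closed.
Proof.
split=> [|a x y /basic_closedP[bx dx] /basic_closedP[by_ dy]].
  by apply/basic_closedP; split=> [xi|]; rewrite ?linear0.
apply/basic_closedP; split=> [xi|]; last by rewrite linearP dx dy scaler0 addr0.
have [cx lx] := bx xi; have [cy ly] := by_ xi.
by rewrite !linearP cx lx cy ly scaler0 addr0.
Qed.

HB.instance Definition _ :=
  GRing.isSubmodClosed.Build F E basic_closed basic_closed_submod.

Record cocycle := Cocycle {
  cocycle_val : E;
  cocycleP : cocycle_val \in basic_closed
}.

HB.instance Definition _ := [isSub for cocycle_val].
HB.instance Definition _ := [Choice of cocycle by <:].
HB.instance Definition _ := [SubChoice_isSubLmodule of cocycle by <:].

Definition coboundary : {pred cocycle} :=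
  [pred z | `[< exists2 y, basic y & \val z = dif D y >]].

Lemma coboundaryP z :
  reflect (exists2 y, basic y & \val z = dif D y) (z \in coboundary).
Proof. exact: asboolP. Qed.

Fact coboundary_submod : submod_closed coboundary.
Proof.
split=> [|a x y /coboundaryP[u bu xu] /coboundaryP[v bv yv]].
  apply/coboundaryP; exists 0; last by rewrite !linear0.
  by move=> xi; rewrite !linear0.
apply/coboundaryP; exists (a *: u + v); last first.
  by rewrite linearD linearZ /= xu yv linearP.
move=> xi; have [cu lu] := bu xi; have [cv lv] := bv xi.
by rewrite !linearP /= cu lu cv lv scaler0 addr0.
Qed.

HB.instance Definition _ :=
  GRing.isSubmodClosed.Build F cocycle coboundary coboundary_submod.

Definition basicH : Type := Quotient.quot coboundary.

HB.instance Definition _ := GRing.Zmodule.on basicH.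
HB.instance Definition _ := EqQuotient.on basicH.

Definition Hclass (z : cocycle) : basicH := \pi_basicH z.

Lemma HclassK (h : basicH) : Hclass (repr h) = h.
Proof. exact: reprK. Qed.

Lemma Hclass_eqP (z z' : cocycle) :
  Hclass z = Hclass z' <-> exists2 y, basic y & \val z - \val z' = dif D y.
Proof.
split=> [/eqP | h].
  by rewrite -Quotient.idealrBE => /coboundaryP; rewrite linearB.
by apply/eqP; rewrite -Quotient.idealrBE; apply/coboundaryP; rewrite linearB.
Qed.

Fact Hclass_zmod_morphism : zmod_morphism Hclass.
Proof. by move=> x y; rewrite /Hclass raddfB. Qed.

HB.instance Definition _ :=
  GRing.isZmodMorphism.Build cocycle basicH Hclass Hclass_zmod_morphism.

Definition Hscale (a : F) (h : basicH) : basicH := Hclass (a *: repr h).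

Lemma HclassZ a z : Hclass (a *: z) = Hscale a (Hclass z).
Proof.
apply/Hclass_eqP.
have /Hclass_eqP[y by_ yE] : Hclass z = Hclass (repr (Hclass z)).
  by rewrite HclassK.
exists (a *: y); last by rewrite 2![\val (a *: _)]linearZ -scalerBr yE linearZ.
by move=> xi; have [cy ly] := by_ xi; rewrite !linearZ /= cy ly scaler0.
Qed.

Fact HscaleA a b h : Hscale a (Hscale b h) = Hscale (a * b) h.
Proof. by rewrite -(HclassK h) -!HclassZ scalerA. Qed.

Fact Hscale1 : left_id 1 Hscale.
Proof. by move=> h; rewrite -(HclassK h) -HclassZ scale1r. Qed.

Fact HscaleDr : right_distributive Hscale +%R.
Proof.
move=> a h k; rewrite -(HclassK h) -(HclassK k).
by rewrite -raddfD -!HclassZ scalerDr raddfD.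
Qed.

Fact HscaleDl h : {morph Hscale^~ h : a b / a + b}.
Proof. by move=> a b; rewrite -(HclassK h) -!HclassZ scalerDl raddfD. Qed.

HB.instance Definition _ :=
  GRing.Zmodule_isLmodule.Build F basicH HscaleA Hscale1 HscaleDr HscaleDl.

End BasicCohomology.

Section BasicCohomologyAlgebra.
Variables (F : fieldType) (g : lieAlgebra F) (A : algType F).
Variable D : gdAlgebra g A.

Lemma derivation1 p (P : A -> A) : super_derivation D p P -> P 1 = 0.
Proof.
have [h1 _] := gda_super D => /(_ false 1 1 h1).
rewrite !mulr1 andbF expr0 scale1r mul1r => /eqP.
by rewrite addrC -subr_eq subrr eq_sym => /eqP.
Qed.

Lemma parity_ker p (P : {linear A -> A}) x0 x1 :
  op_parity D p P -> homog D false x0 -> homog D true x1 ->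
  P (x0 + x1) = 0 -> P x0 = 0 /\ P x1 = 0.
Proof.
move=> parP hx0 hx1; rewrite linearD => /eqP; rewrite addr_eq0 => /eqP Px0.
suff Px1 : P x1 = 0 by rewrite Px0 Px1 oppr0.
have := parP _ _ hx0; rewrite Px0 => h0; have h1 := parP _ _ hx1.
have {}h0 : homog D (p (+) false) (P x1).
  by have := homog_linear (-1) h0 (homog0 D _); rewrite scaleN1r opprK addr0.
by case: p h0 h1 {parP} => /= h0 h1; apply: (homog_disjoint D).
Qed.

Lemma derivation_ker p (P : {linear A -> A}) x y :
  super_derivation D p P -> op_parity D p P ->
  P x = 0 -> P y = 0 -> P (x * y) = 0.
Proof.
move=> derP parP Px Py; have [x0 [x1 [hx0 hx1 xE]]] := homog_decomp D x.
rewrite xE in Px *; have [Px0 Px1] := parity_ker parP hx0 hx1 Px.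
rewrite mulrDl linearD /= (derP _ _ _ hx0) (derP _ _ _ hx1).
by rewrite Px0 Px1 Py !mul0r !mulr0 !scaler0 !addr0.
Qed.

Lemma basicM x y : basic D x -> basic D y -> basic D (x * y).
Proof.
move=> bx by_ xi; have [cx lx] := bx xi; have [cy ly] := by_ xi; split.
  exact: (derivation_ker (contr_derivation D xi) (contr_parity D xi)).
exact: (derivation_ker (lie_derivation D xi) (lie_parity D xi)).
Qed.

Fact basic_closed_subring : subring_closed (basic_closed D).
Proof.
split=> [|x y|x y /basic_closedP[bx dx] /basic_closedP[by_ dy]].
- apply/basic_closedP; split=> [xi|]; last first.
    exact: derivation1 (dif_derivation D).
  split; first exact: derivation1 (contr_derivation D xi).
  exact: derivation1 (lie_derivation D xi).
- exact: rpredB.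
apply/basic_closedP; split; first exact: basicM.
exact: (derivation_ker (dif_derivation D) (dif_parity D)).
Qed.

HB.instance Definition _ :=
  GRing.isSubringClosed.Build A (basic_closed D) basic_closed_subring.
HB.instance Definition _ :=
  GRing.SubZmodule_isSubPzRing.Build A _ (cocycle D) (subringClosedP _).

Fact Hclass_mull (u v t : cocycle D) :
  Hclass u = Hclass v -> Hclass (u * t) = Hclass (v * t).
Proof.
move=> /Hclass_eqP[y by_ yE]; have /basic_closedP[bt dt] := valP t.
have [y0 [y1 [hy0 hy1 yE']]] := homog_decomp D y.
apply/Hclass_eqP; exists (y * \val t); first exact: basicM.
rewrite !rmorphM -mulrBl yE yE' mulrDl !linearD /= mulrDl.
rewrite (dif_derivation D _ _ hy0) (dif_derivation D _ _ hy1) dt.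
by rewrite !mulr0 !scaler0 !addr0.
Qed.

Fact Hclass_mulr (u v t : cocycle D) :
  Hclass u = Hclass v -> Hclass (t * u) = Hclass (t * v).
Proof.
move=> /Hclass_eqP[y by_ yE]; have /basic_closedP[bt dt] := valP t.
have [t0 [t1 [ht0 ht1 tE]]] := homog_decomp D (\val t).
rewrite tE in bt dt; have [dt0 dt1] := parity_ker (dif_parity D) ht0 ht1 dt.
have bt0 : basic D t0.
  move=> xi; have [ct lt] := bt xi; split.
    by have [] := parity_ker (contr_parity D xi) ht0 ht1 ct.
  by have [] := parity_ker (lie_parity D xi) ht0 ht1 lt.
have bt1 : basic D t1.
  move=> xi; have [ct lt] := bt xi; split.
    by have [] := parity_ker (contr_parity D xi) ht0 ht1 ct.
  by have [] := parity_ker (lie_parity D xi) ht0 ht1 lt.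
apply/Hclass_eqP; exists (t0 * y - t1 * y).
  move=> xi; rewrite !linearB /=.
  have [c0 l0] := basicM bt0 by_ xi; have [c1 l1] := basicM bt1 by_ xi.
  by rewrite c0 l0 c1 l1 subr0.
rewrite !rmorphM -mulrBr yE /= [val t]tE mulrDl linearB /=.
rewrite (dif_derivation D _ _ ht0) (dif_derivation D _ _ ht1) dt0 dt1.
by rewrite !mul0r !add0r expr0 expr1 scale1r scaleN1r opprK.
Qed.

Definition Hone : basicH D := Hclass (1 : cocycle D).
Definition Hmul (h k : basicH D) : basicH D := Hclass (repr h * repr k).

Lemma HclassM (z w : cocycle D) : Hclass (z * w) = Hmul (Hclass z) (Hclass w).
Proof.
rewrite /Hmul (@Hclass_mull z (repr (Hclass z))) ?HclassK //.
by apply: Hclass_mulr; rewrite HclassK.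
Qed.

Fact HmulA : associative Hmul.
Proof.
by move=> h k l; rewrite -(HclassK h) -(HclassK k) -(HclassK l) -!HclassM mulrA.
Qed.

Fact Hmul1l : left_id Hone Hmul.
Proof. by move=> h; rewrite -(HclassK h) -HclassM mul1r. Qed.

Fact Hmul1r : right_id Hone Hmul.
Proof. by move=> h; rewrite -(HclassK h) -HclassM mulr1. Qed.

Fact HmulDl : left_distributive Hmul +%R.
Proof.
move=> h k l; rewrite -(HclassK h) -(HclassK k) -(HclassK l).
by rewrite -raddfD -!HclassM mulrDl raddfD.
Qed.

Fact HmulDr : right_distributive Hmul +%R.
Proof.
move=> h k l; rewrite -(HclassK h) -(HclassK k) -(HclassK l).
by rewrite -raddfD -!HclassM mulrDr raddfD.
Qed.

HB.instance Definition _ :=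
  GRing.Zmodule_isPzRing.Build (basicH D) HmulA Hmul1l Hmul1r HmulDl HmulDr.

End BasicCohomologyAlgebra.

Section InducedMap.
Variables (F : fieldType) (g : lieAlgebra F) (E E' : lmodType F).
Variables (D : gdSpace g E) (D' : gdSpace g E') (f : gdsHom D D').

Fact cocycle_map_subproof (z : cocycle D) : f (\val z) \in basic_closed D'.
Proof.
have /basic_closedP[bz dz] := valP z; apply/basic_closedP.
split=> [xi|]; last by rewrite -gdsHom_dif dz linear0.
have [cz lz] := bz xi.
by rewrite -gdsHom_contr -gdsHom_lie cz lz linear0.
Qed.

Definition cocycle_map (z : cocycle D) : cocycle D' :=
  Cocycle (cocycle_map_subproof z).

Definition Hmap (h : basicH D) : basicH D' := Hclass (cocycle_map (repr h)).

Lemma HmapE z : Hmap (Hclass z) = Hclass (cocycle_map z).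
Proof.
have /Hclass_eqP[y by_ yE] : Hclass (repr (Hclass z)) = Hclass z.
  by rewrite HclassK.
apply/Hclass_eqP; exists (f y); last by rewrite -gdsHom_dif -yE linearB.
move=> xi; have [cy ly] := by_ xi.
by rewrite -gdsHom_contr -gdsHom_lie cy ly linear0.
Qed.

End InducedMap.

Record connection (F : fieldType) (g : lieAlgebra F) (A : algType F)
    (D : gdAlgebra g A) := Connection {
  conn_fun :> {linear dual g -> A};
  conn_odd : forall mu, homog D true (conn_fun mu);
  conn_contr : forall xi mu,
    contr D xi (conn_fun mu) = ((mu : 'Hom(g, F^o)) xi : F)%:A;
  conn_lie : forall xi mu, lie D xi (conn_fun mu) = - conn_fun (coad xi mu)
}.

(* Freeness of a super-commutative algebra W on odd generators [od mu] and even *)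
(* generators [ev mu] linear in [mu]: the universal property.                   *)
Definition free_super_commutative (F : fieldType) (g : lieAlgebra F)
    (W : algType F) (G : grading W) (od ev : dual g -> W) :=
  forall (B : algType F) (GB : grading B),
    super_algebra GB -> super_commutative GB ->
  forall f h : {linear dual g -> B},
    (forall mu, homog GB true (f mu)) -> (forall mu, homog GB false (h mu)) ->
  let extends (phi : {lrmorphism W -> B}) :=
    [/\ forall i x, homog G i x -> homog GB i (phi x),
        forall mu, phi (od mu) = f mu & forall mu, phi (ev mu) = h mu] in
  exists2 phi, extends phi & forall psi, extends psi -> psi =1 phi.

Record weilAlgebra (F : fieldType) (g : lieAlgebra F) := WeilAlgebra {
  weil_sort :> algType F;
  weil_gda : gdAlgebra g weil_sort;
  weil_odd : {linear dual g -> weil_sort};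
  weil_even : {linear dual g -> weil_sort};
  weil_odd_homog : forall mu, homog weil_gda true (weil_odd mu);
  weil_even_homog : forall mu, homog weil_gda false (weil_even mu);
  weil_super_commutative : super_commutative weil_gda;
  weil_free : free_super_commutative weil_gda weil_odd weil_even;
  weil_dif_odd : forall mu, dif weil_gda (weil_odd mu) = weil_even mu;
  weil_dif_even : forall mu, dif weil_gda (weil_even mu) = 0;
  weil_lie_odd : forall xi mu,
    lie weil_gda xi (weil_odd mu) = - weil_odd (coad xi mu);
  weil_lie_even : forall xi mu,
    lie weil_gda xi (weil_even mu) = - weil_even (coad xi mu);
  weil_contr_odd : forall xi mu,
    contr weil_gda xi (weil_odd mu) = ((mu : 'Hom(g, F^o)) xi : F)%:A;
  weil_contr_even : forall xi mu,
    contr weil_gda xi (weil_even mu) = - weil_odd (coad xi mu)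
}.

Section SymmetricSubalgebra.
Variables (F : fieldType) (g : lieAlgebra F) (W : weilAlgebra g).

Definition in_wedge2 (w : W) :=
  exists n (mu nu : 'I_n -> dual g),
    w = \sum_(i < n) weil_odd W (mu i) * weil_odd W (nu i).

Definition is_lambda (mu : dual g) (w : W) :=
  in_wedge2 w /\
  forall xi, contr (weil_gda W) xi w = - weil_odd W (coad xi mu).

(* The copy of S(g^* ) in W: the unital subalgebra generated by the elements *)
(* weil_even mu - lambda mu.                                                 *)
Inductive in_Sg : W -> Prop :=
| Sg_hat mu l of is_lambda mu l : in_Sg (weil_even W mu - l)
| Sg_scalar a : in_Sg a%:A
| Sg_add x y of in_Sg x & in_Sg y : in_Sg (x + y)
| Sg_mul x y of in_Sg x & in_Sg y : in_Sg (x * y).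

Definition in_Sg_inv (w : W) :=
  in_Sg w /\ forall xi, lie (weil_gda W) xi w = 0.

End SymmetricSubalgebra.

Section Symmetrization.
Variables (F : fieldType) (g : lieAlgebra F) (W : weilAlgebra g).
Variables (A : algType F) (D : gdAlgebra g A).

(* A generator of W is coded by its parity and the element of g^* . *)
Definition generator (v : bool * dual g) : W :=
  if v.1 then weil_odd W v.2 else weil_even W v.2.

Definition phi (theta : connection D) (v : bool * dual g) : A :=
  if v.1 then theta v.2 else dif D (theta v.2).

(* The exponent of the sign of v_0 ... v_(k-1) -> v_(t 0) ... v_(t (k-1)), where *)
(* t = s^-1: the number of pairs of odd factors that t puts in the wrong order.  *)
Definition inversions k (v : 'I_k -> bool * dual g) (s : 'S_k) : nat :=
  let t := (s^-1)%g in
  #|[set p : 'I_k * 'I_k |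
      [&& (p.1 < p.2)%N, (v (t p.1)).1, (v (t p.2)).1 & (t p.1 > t p.2)%N]]|.

Definition is_symmetrization (theta : connection D) (c : W -> A) :=
  forall k (v : 'I_k -> bool * dual g),
    c (\prod_(i < k) generator (v i)) =
    (k`!%:R)^-1 *: \sum_(s : 'S_k)
      (-1) ^+ inversions v s *: \prod_(i < k) phi theta (v ((s^-1)%g i)).

End Symmetrization.

(* Main.v *)
(* The algebra W is generated by letters, a basis of its generators, and      *)
(* carries superderivations d/dx_a for each letter a (obtained from the       *)
(* universal property applied to a square-zero extension of W). Up to the     *)
(* factor 1/k!, the symmetrization map sends w to                             *)
(*   P_k w = sum_a phi_a P_(k-1) (d w / dx_a)                                 *)
(* on words of length k; commuting the operators d and iota past the d/dx_a   *)
(* shows that it is a morphism of differential spaces.                        *)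
(* For the cohomological statements, let q be basic. In the super-commutative *)
(* algebra W (x) W, which has the two connections od (x) 1 and 1 (x) od, the  *)
(* elements q (x) 1 and 1 (x) q differ by the differential of a basic element:*)
(* with koszul the derivation mapping 1 (x) ev to 1 (x) od - od (x) 1 and     *)
(* killing the other generators, the operator [d, koszul] counts the degree in*)
(* the difference of the two connections, and a polynomial in it inverts it.  *)
(* Applying the morphism u (x) v |-> c (p u) c' (v) to this primitive, for two*)
(* symmetrization maps c, c' and a basic p, gives independence of the         *)
(* connection (p = 1) and multiplicativity (c = c').                          *)
Require Import Defs.
From HB Require Import structures.
From mathcomp Require Import all_boot all_algebra perm.
From mathcomp Require Import boolp.

Set Implicit Arguments.
Unset Strict Implicit.
Unset Printing Implicit Defensive.

Import GRing.Theory.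
Local Open Scope ring_scope.

(** * Super vector spaces and dual bases *)

(** The universal property of [W] shows that words in the letters span [W] ([weil_generated],
    [weil_word_ind]) and yields the augmentation and the partial derivatives. An identity between
    derivations then need only be checked on letters ([weil_derivation_eq]).

    Basic elements: composing the operators [w - od i * contr D (lie_basis i) w] projects [W] onto
    its horizontal part and lands in the symmetric subalgebra ([horizontal_projs_Sg]). Hence basic
    elements are even, and [d], being odd and preserving them, is zero on them ([dif_basic]).

    Symmetrization: a derivation sending letters to generators plus constants is compared with its
    counterpart on [A] ([sym_part_intertwine]). The contributions of the constants telescope after
    division by k! ([symmetrization_intertwine]). This handles [d] and the contractions; Lie
    derivatives follow from Cartan's formula. The recursion unfolds to the permutation sum in
    [sym_part_prod_generator].

    Cohomology: if a bilinear map [m] on [W] intertwines [d] and the contractions, then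
    [m 1 q - m q 1] is [d] of a basic element for [q] basic ([pairing_transgression]). With
    [m u v = f (p * u) * h v] this makes [f p * h q] cohomologous to [f (p * q) * h 1]
    ([gdsHom_basic_mul]), which gives both independence of the connection and multiplicativity. *)

Section GradedSpace.
Variables (F : fieldType) (E : lmodType F) (G : grading E).

Lemma homogD i x y : homog G i x -> homog G i y -> homog G i (x + y).
Proof. by move=> hx /(homog_linear 1 hx); rewrite scale1r. Qed.

Lemma homogZ i a x : homog G i x -> homog G i (a *: x).
Proof. by move=> hx; rewrite -[_ *: _]addr0; apply: homog_linear (homog0 G i). Qed.

Lemma homogN i x : homog G i x -> homog G i (- x).
Proof. by rewrite -scaleN1r; apply: homogZ. Qed.

Lemma homogB i x y : homog G i x -> homog G i y -> homog G i (x - y).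
Proof. by move=> hx /homogN; apply: homogD. Qed.

Lemma homog_sum i I (r : seq I) (P : pred I) (f : I -> E) :
  (forall k, P k -> homog G i (f k)) -> homog G i (\sum_(k <- r | P k) f k).
Proof.
move=> h; elim/big_ind: _ => //; first exact: homog0.
by move=> x y; apply: homogD.
Qed.

Lemma homog_ind (P : E -> Prop) :
    (forall i x, homog G i x -> P x) ->
    (forall x y, P x -> P y -> P (x + y)) ->
  forall x, P x.
Proof.
move=> Ph PD x; have [x0 [x1 [h0 h1 ->]]] := homog_decomp G x.
by apply: PD; [apply: Ph h0 | apply: Ph h1].
Qed.

End GradedSpace.

Lemma super_alternating (F : fieldType) (A : algType F) (G : grading A) x :
  2%:R != 0 :> F -> super_commutative G -> homog G true x -> x * x = 0.
Proof.
move=> F2 cG hx; have := cG _ _ _ _ hx hx; rewrite expr1 scaleN1r => /eqP.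
rewrite -addr_eq0 -mulr2n -scaler_nat scaler_eq0 (negPf F2) /=.
by move/eqP.
Qed.

Section DualBasis.
Variables (F : fieldType) (g : lieAlgebra F).

Definition lie_basis (i : 'I_(\dim {:g})) : g := (vbasis {:g})`_i.

Definition dual_basis (i : 'I_(\dim {:g})) : dual g :=
  linfun (coord (vbasis {:g}) i : g -> F^o).

Lemma dual_basisE i x : (dual_basis i : 'Hom(g, F^o)) x = coord (vbasis {:g}) i x.
Proof. by rewrite lfunE. Qed.

Lemma dual_basis_lie_basis i j :
  (dual_basis i : 'Hom(g, F^o)) (lie_basis j) = (i == j)%:R.
Proof.
have fB : free (vbasis {:g}) := basis_free (vbasisP {:g}).
by rewrite dual_basisE /lie_basis (coord_free j i fB) eq_sym.
Qed.

Lemma lie_basis_expand (x : g) :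
  x = \sum_i (dual_basis i : 'Hom(g, F^o)) x *: lie_basis i.
Proof.
rewrite {1}(coord_vbasis (memvf x)).
by apply: eq_bigr => i _; rewrite dual_basisE.
Qed.

Lemma dual_basis_expand (mu : dual g) :
  mu = \sum_i ((mu : 'Hom(g, F^o)) (lie_basis i) : F) *: dual_basis i.
Proof.
apply/lfunP => x; rewrite sum_lfunE {1}(lie_basis_expand x) linear_sum.
by apply: eq_bigr => i _; rewrite linearZ scale_lfunE; apply: mulrC.
Qed.

End DualBasis.

(** * Generation of the Weil algebra *)

Section GeneratedSubalgebra.
Variables (F : fieldType) (g : lieAlgebra F) (W : weilAlgebra g).

Inductive generated : W -> Prop :=
| generated_odd mu : generated (weil_odd W mu)
| generated_even mu : generated (weil_even W mu)
| generated_scalar a : generated a%:A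
| generated_add x y of generated x & generated y : generated (x + y)
| generated_mul x y of generated x & generated y : generated (x * y).

Definition generated_pred : {pred W} := [pred x | `[< generated x >]].

Lemma generatedP x : reflect (generated x) (x \in generated_pred).
Proof. exact: asboolP. Qed.

Fact generated_subalg : subalg_closed generated_pred.
Proof.
split=> [|a x y /generatedP gx /generatedP gy|x y /generatedP gx /generatedP gy];
  apply/generatedP.
- by rewrite -[1]scale1r; apply: generated_scalar.
- rewrite -mulr_algl; apply: generated_add gy.
  exact: generated_mul (generated_scalar a) gx.
- exact: generated_mul.
Qed.

HB.instance Definition _ :=
  GRing.isSubalgClosed.Build F W generated_pred generated_subalg.

Record generatedType := GeneratedElt {
  generated_val : W;
  generated_valP : generated_val \in generated_pred
}.

HB.instance Definition _ := [isSub for generated_val].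
HB.instance Definition _ := [Choice of generatedType by <:].
HB.instance Definition _ := [SubChoice_isSubAlgebra of generatedType by <:].

Definition generated_homog i (x : generatedType) : Prop :=
  homog (weil_gda W) i (\val x).

(** The grading restricts to the subalgebra only if the even and odd components of a generated
    element are again generated, which goes by induction on the generation. *)
Fact generated_homog_decomp (x : generatedType) : exists x0 x1,
  [/\ generated_homog false x0, generated_homog true x1 & x = x0 + x1].
Proof.
suff [x0 [x1 [g0 g1 [h0 h1 xE]]]] : exists x0 x1 : W,
    [/\ generated x0, generated x1 & [/\ homog (weil_gda W) false x0,
      homog (weil_gda W) true x1 & \val x = x0 + x1]].
  exists (GeneratedElt (introT (generatedP _) g0)).
  exists (GeneratedElt (introT (generatedP _) g1)).
  by split=> //; apply: val_inj; rewrite raddfD.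
have [W1 WM] := gda_super (weil_gda W).
have g0 : generated 0 by rewrite -[0](scale0r 1); apply: generated_scalar.
have /generatedP := valP x; elim=> [mu|mu|a|y z _|y z _].
- exists 0, (weil_odd W mu); rewrite add0r; split=> //.
    exact: generated_odd.
  by split; rewrite //; [apply: homog0 | apply: weil_odd_homog].
- exists (weil_even W mu), 0; rewrite addr0; split=> //.
    exact: generated_even.
  by split; rewrite //; [apply: weil_even_homog | apply: homog0].
- exists a%:A, 0; rewrite addr0; split=> //; first exact: generated_scalar.
  by split; rewrite //; [apply: homogZ | apply: homog0].
- move=> [y0 [y1 [gy0 gy1 [hy0 hy1 ->]]]] _ [z0 [z1 [gz0 gz1 [hz0 hz1 ->]]]].
  exists (y0 + z0), (y1 + z1); split; try exact: generated_add.
  by split; [apply: homogD | apply: homogD | rewrite addrACA].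
move=> [y0 [y1 [gy0 gy1 [hy0 hy1 ->]]]] _ [z0 [z1 [gz0 gz1 [hz0 hz1 ->]]]].
exists (y0 * z0 + y1 * z1), (y0 * z1 + y1 * z0).
split; try by apply: generated_add; apply: generated_mul.
split.
- by apply: homogD; [apply: (WM _ false _ _ hy0) | apply: (WM _ true _ _ hy1)].
- by apply: homogD; [apply: (WM _ true _ _ hy0) | apply: (WM _ false _ _ hy1)].
by rewrite mulrDl !mulrDr [y1 * z0 + _]addrC addrACA.
Qed.

Definition generated_grading : grading generatedType.
Proof.
apply: (@Grading F generatedType generated_homog) => [i|i a x y|x|x].
- by rewrite /generated_homog raddf0; apply: homog0.
- by rewrite /generated_homog linearP; apply: homog_linear.
- exact: generated_homog_decomp.
- move=> h0 h1; apply: val_inj; rewrite raddf0.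
  exact: (homog_disjoint (weil_gda W)).
Defined.

(* The universal property yields a retraction of W onto the subalgebra, and *)
(* followed by the inclusion it must be the identity, again by uniqueness.  *)
Lemma weil_generated (w : W) : generated w.
Proof.
pose G := generated_grading.
have GS : super_algebra G.
  split; first by rewrite /= /generated_homog rmorph1; case: (gda_super (weil_gda W)).
  move=> i j x y; rewrite /= /generated_homog rmorphM.
  by case: (gda_super (weil_gda W)) => _ WM; apply: WM.
have GC : super_commutative G.
  move=> i j x y hx hy; apply: val_inj; rewrite linearZ !rmorphM.
  exact: (weil_super_commutative hx hy).
pose od mu := GeneratedElt (introT (generatedP _) (generated_odd mu)).
pose ev mu := GeneratedElt (introT (generatedP _) (generated_even mu)).
have od_lin : linear od by move=> a x y; apply: val_inj; rewrite [RHS]linearP /= linearP.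
have ev_lin : linear ev by move=> a x y; apply: val_inj; rewrite [RHS]linearP /= linearP.
pose odL : {linear dual g -> generatedType} :=
  HB.pack od (GRing.isLinear.Build F (dual g) generatedType _ od od_lin).
pose evL : {linear dual g -> generatedType} :=
  HB.pack ev (GRing.isLinear.Build F (dual g) generatedType _ ev ev_lin).
have [p [p_homog p_od p_ev] _] := @weil_free _ _ W _ G GS GC odL evL
  (@weil_odd_homog _ _ W) (@weil_even_homog _ _ W).
pose q0 x := generated_val (p x).
have q_lin : linear q0 by move=> a x y; rewrite /q0 linearP [LHS](linearP \val).
have q_mul : monoid_morphism q0.
  by split=> [|x y]; rewrite /q0 ?rmorph1 // rmorphM [LHS](rmorphM \val).
pose q : {lrmorphism W -> W} := HB.pack q0
  (GRing.isLinear.Build F W W _ q0 q_lin)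
  (GRing.isMonoidMorphism.Build W W q0 q_mul).
have [i _ uniq] := @weil_free _ _ W _ _ (gda_super (weil_gda W))
  (@weil_super_commutative _ _ W) _ _ (@weil_odd_homog _ _ W)
  (@weil_even_homog _ _ W).
have qE x : q x = x.
  rewrite (uniq q); last first.
    by split=> [i1 y hy|mu|mu]; rewrite /= /q0 ?p_od ?p_ev //; apply: p_homog.
  by rewrite -[RHS]/(idfun x) (uniq idfun).
by apply/generatedP; rewrite -[w]qE; apply: valP.
Qed.

End GeneratedSubalgebra.

(** * The parity involution and square-zero extensions *)

Section ParityInvolution.
Variables (F : fieldType) (E : lmodType F) (G : grading E).

(** The decomposition is only known to exist, so [cid] picks one; by [graded_parts_uniq] the choice
    does not matter. *)
Definition graded_parts (x : E) : E * E :=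
  let: exist x0 h0 := cid (homog_decomp G x) in (x0, projT1 (cid h0)).

Lemma graded_partsP x :
  [/\ homog G false (graded_parts x).1, homog G true (graded_parts x).2 &
      x = (graded_parts x).1 + (graded_parts x).2].
Proof. by rewrite /graded_parts; case: cid => x0 h0 /=; case: cid. Qed.

Lemma graded_parts_uniq x x0 x1 :
    homog G false x0 -> homog G true x1 -> x = x0 + x1 ->
  graded_parts x = (x0, x1).
Proof.
have [] := graded_partsP x; case: graded_parts => y0 y1 /= hy0 hy1 -> hx0 hx1 yx.
have e : y0 - x0 = x1 - y1.
  by apply/eqP; rewrite subr_eq addrAC eq_sym subr_eq yx addrC.
have d0 : y0 - x0 = 0.
  apply: (homog_disjoint G); first exact: homogB.
  by rewrite e; apply: homogB.
congr (_, _); apply/eqP; first by rewrite -subr_eq0 d0.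
by rewrite eq_sym -subr_eq0 -e d0.
Qed.

(* Locked, since [linearD] would otherwise match the sum inside [ginv]. *)
Definition ginv (p : bool) (x : E) : E :=
  locked ((graded_parts x).1 + (-1) ^+ p *: (graded_parts x).2).

Lemma ginv_decomp p x0 x1 : homog G false x0 -> homog G true x1 ->
  ginv p (x0 + x1) = x0 + (-1) ^+ p *: x1.
Proof. by move=> h0 h1; rewrite /ginv -lock (graded_parts_uniq h0 h1). Qed.

Lemma ginv_homog p i x : homog G i x -> ginv p x = (-1) ^+ (p && i) *: x.
Proof.
case: i => hx; rewrite ?andbT ?andbF.
  by rewrite -[x in LHS]add0r ginv_decomp ?add0r //; apply: homog0.
rewrite -[x in LHS]addr0 ginv_decomp ?scaler0 ?addr0 ?scale1r //.
exact: homog0.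
Qed.

Fact ginv_linear p : linear (ginv p).
Proof.
move=> a x y; have [hx0 hx1 xE] := graded_partsP x.
have [hy0 hy1 yE] := graded_partsP y.
rewrite {1}xE {1}yE scalerDr addrACA ginv_decomp; try exact: homog_linear.
rewrite /ginv -!lock [a *: (_ + _)]scalerDr [RHS]addrACA [a *: (_ *: _)]scalerA [a * _]mulrC.
by rewrite -scalerA -scalerDr.
Qed.

HB.instance Definition _ p :=
  GRing.isLinear.Build F E E _ (ginv p) (ginv_linear p).

Lemma homog_ginv p i x : homog G i x -> homog G i (ginv p x).
Proof. by move=> hx; rewrite (ginv_homog p hx); apply: homogZ. Qed.

Lemma ginvK p : involutive (ginv p).
Proof.
apply: (homog_ind (G := G)) => [i x hx|x y ex ey]; last by rewrite !linearD /= ex ey.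
by rewrite !(ginv_homog p hx) linearZ /= (ginv_homog p hx) scalerA -expr2 sqrr_sign scale1r.
Qed.

Lemma ginv_op p q (P : {linear E -> E}) x :
  op_parity G q P -> ginv p (P x) = (-1) ^+ (p && q) *: P (ginv p x).
Proof.
move=> PP; elim/(@homog_ind _ _ G): x => [i x hx|x y ex ey]; last first.
  by rewrite !linearD /= ex ey.
rewrite (ginv_homog p (PP _ _ hx)) (ginv_homog p hx) linearZ /= scalerA.
by rewrite -signr_addb; case: p q i {PP hx} => [] [] [].
Qed.

End ParityInvolution.

Section SuperAlgebraTheory.
Variables (F : fieldType) (A : algType F) (G : grading A).
Hypothesis GS : super_algebra G.

Lemma homog1 : homog G false 1.
Proof. by case: GS. Qed.

Lemma homogM i j x y : homog G i x -> homog G j y -> homog G (i (+) j) (x * y).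
Proof. by case: GS => _; apply. Qed.

Lemma ginv1 p : ginv G p 1 = 1.
Proof. by rewrite (ginv_homog p homog1) andbF scale1r. Qed.

Lemma ginvM p x y : ginv G p (x * y) = ginv G p x * ginv G p y.
Proof.
elim/(@homog_ind _ _ G): x => [i x hx|x x' ex ex']; last first.
  by rewrite mulrDl !linearD /= mulrDl ex ex'.
elim/(@homog_ind _ _ G): y => [j y hy|y y' ey ey']; last first.
  by rewrite mulrDr !linearD /= mulrDr ey ey'.
rewrite (ginv_homog p hx) (ginv_homog p hy) (ginv_homog p (homogM hx hy)).
rewrite -scalerAl -scalerAr scalerA -signr_addb.
by case: p i j {hx hy} => [] [] [].
Qed.

(** With [ginv] in place of the sign, the Leibniz rule needs no homogeneity of [x]. *)
Lemma sderE p (P : {linear A -> A}) x y : super_derivation G p P ->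
  P (x * y) = P x * y + ginv G p x * P y.
Proof.
move=> dP; elim/(@homog_ind _ _ G): x => [i x hx|x x' ex ex'].
  by rewrite (dP _ _ _ hx) (ginv_homog p hx) -scalerAl.
by rewrite mulrDl !linearD /= ex ex' !mulrDl addrACA.
Qed.

Lemma super_commE i x y : super_commutative G -> homog G i x ->
  x * y = ginv G i y * x.
Proof.
move=> GC hx; elim/(@homog_ind _ _ G): y => [j y hy|y y' ey ey'].
  by rewrite (GC _ _ _ _ hx hy) (ginv_homog i hy) -scalerAl.
by rewrite mulrDr linearD /= mulrDl ey ey'.
Qed.

End SuperAlgebraTheory.

(* A[e]/(e^2) with e of parity [p]; (x, x') stands for x + e x'. *)
Definition sqz_ext (F : fieldType) (A : algType F) (G : grading A)
  (GS : super_algebra G) (p : bool) : Type := (A * A)%type.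

Section SquareZeroExtension.
Variables (F : fieldType) (A : algType F) (G : grading A).
Variables (GS : super_algebra G) (p : bool).
Local Notation sqz := (sqz_ext GS p).

HB.instance Definition _ := GRing.Lmodule.copy sqz (A * A)%type.

Definition sqz_one : sqz := (1, 0).
(** Moving [e] to the left past [x.1] turns [x.1] into [ginv G p x.1]. *)
Definition sqz_mul (x y : sqz) : sqz :=
  (x.1 * y.1, x.2 * y.1 + ginv G p x.1 * y.2).

Fact sqz_mulA : associative sqz_mul.
Proof.
move=> x y z; congr (_, _) => /=; first by rewrite mulrA.
by rewrite (ginvM GS) mulrDl mulrDr !mulrA addrA.
Qed.

Fact sqz_mul1r : left_id sqz_one sqz_mul.
Proof.
by case=> x x'; rewrite /sqz_mul /= (ginv1 GS) !mul1r mul0r add0r.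
Qed.

Fact sqz_mulr1 : right_id sqz_one sqz_mul.
Proof. by case=> x x'; rewrite /sqz_mul /= !mulr1 mulr0 addr0. Qed.

Fact sqz_mulDl : left_distributive sqz_mul +%R.
Proof.
move=> x y z; congr (_, _) => /=; first by rewrite mulrDl.
by rewrite linearD /= !mulrDl addrACA.
Qed.

Fact sqz_mulDr : right_distributive sqz_mul +%R.
Proof.
move=> x y z; congr (_, _) => /=; first by rewrite mulrDr.
by rewrite !mulrDr addrACA.
Qed.

Fact sqz_oner_neq0 : sqz_one != 0.
Proof. by apply/eqP => - [] /eqP; rewrite oner_eq0. Qed.

HB.instance Definition _ := GRing.Zmodule_isNzRing.Build sqz
  sqz_mulA sqz_mul1r sqz_mulr1 sqz_mulDl sqz_mulDr sqz_oner_neq0.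

Fact sqz_scaleAl (a : F) (x y : sqz) : a *: (x * y) = (a *: x : sqz) * y.
Proof.
congr (_, _) => /=; first by rewrite scalerAl.
by rewrite linearZ /= scalerDr !scalerAl.
Qed.

HB.instance Definition _ := GRing.Lmodule_isLalgebra.Build F sqz sqz_scaleAl.

Fact sqz_scaleAr (a : F) (x y : sqz) : a *: (x * y) = x * (a *: y : sqz).
Proof.
congr (_, _) => /=; first by rewrite scalerAr.
by rewrite scalerDr !scalerAr.
Qed.

HB.instance Definition _ := GRing.Lalgebra_isAlgebra.Build F sqz sqz_scaleAr.

Definition sqz_homog i (x : sqz) := homog G i x.1 /\ homog G (p (+) i) x.2.

Definition sqz_grading : grading sqz.
Proof.
apply: (@Grading F sqz sqz_homog) => [i|i a x y|[x x']|[x x'] [h0 k0] [h1 k1]].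
- by split; apply: homog0.
- by move=> [h0 k0] [h1 k1]; split; apply: homog_linear.
- have [h0 h1 xE] := graded_partsP G x; have [k0 k1 yE] := graded_partsP G x'.
  pose k := graded_parts G x'.
  exists ((graded_parts G x).1, if p then k.2 else k.1).
  exists ((graded_parts G x).2, if p then k.1 else k.2).
  split; try by split; rewrite //= /k; case: (p).
  rewrite {1}xE {1}yE; congr (_, _) => /=.
  by case: (p); rewrite // addrC.
congr (_, _); first exact: homog_disjoint h0 h1.
by case: (p) k0 k1 => k0 k1; apply: (homog_disjoint G).
Defined.

Lemma sqz_super : super_algebra sqz_grading.
Proof.
split=> [|i j x y [hx hx'] [hy hy']]; first by split; [apply: homog1|apply: homog0].
split; first exact: homogM.
apply: homogD; first by rewrite addbA; apply: homogM.
by rewrite addbCA; apply: homogM => //; apply: homog_ginv.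
Qed.

Lemma sqz_super_commutative : super_commutative G -> super_commutative sqz_grading.
Proof.
move=> GC i j x y [hx hx'] [hy hy']; congr (_, _) => /=; first exact: GC.
rewrite (ginv_homog p hx) (ginv_homog p hy) -!scalerAl.
rewrite (GC _ _ _ _ hx' hy) (GC _ _ _ _ hx hy') addrC scalerDr !scalerA -!signr_addb.
by congr (_ *: _ + _ *: _); congr (_ ^+ nat_of_bool _); case: p i j {hx hx' hy hy'} => [] [] [].
Qed.

End SquareZeroExtension.

Notation letter g := (bool * 'I_(\dim {: lie_sort g}))%type.

(** * Partial derivatives on the Weil algebra *)

Section Letters.
Variables (F : fieldType) (g : lieAlgebra F).

Definition letter_val (a : letter g) : bool * dual g := (a.1, dual_basis a.2).

Definition letter_coef (v : bool * dual g) (a : letter g) : F :=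
  (v.1 == a.1)%:R * (v.2 : 'Hom(g, F^o)) (lie_basis a.2).

Lemma letter_coef_val a b : letter_coef (letter_val a) b = (a == b)%:R.
Proof.
rewrite /letter_coef /= dual_basis_lie_basis -natrM mulnb.
by case: a b => [a i] [b j].
Qed.

Fact letter_coef_linear p a :
  linear (fun mu : dual g => letter_coef (p, mu) a : F^o).
Proof.
move=> c mu nu; rewrite /letter_coef /= add_lfunE scale_lfunE mulrDr.
by rewrite [_ *: _ in RHS]/GRing.scale /= mulrCA.
Qed.

(** Letters of parity other than [p] have coefficient zero, so [h] is constrained only on those of
    parity [p]. *)
Lemma sum_letter_coef (V : lmodType F) p mu (h : letter g -> V)
    (f : {linear dual g -> V}) : (forall i, h (p, i) = f (dual_basis i)) ->
  \sum_a letter_coef (p, mu) a *: h a = f mu.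
Proof.
move=> hf.
transitivity (\sum_q \sum_i letter_coef (p, mu) (q, i) *: h (q, i)).
  by rewrite pair_bigA; apply: eq_bigr => -[].
rewrite (bigD1 p) //= [X in _ + X]big1 ?addr0 => [|q qp].
  rewrite {2}(dual_basis_expand mu) linear_sum; apply: eq_bigr => i _.
  by rewrite hf linearZ /letter_coef /= eqxx mul1r.
by apply: big1 => i _; rewrite /letter_coef /= eq_sym (negPf qp) mul0r scale0r.
Qed.

End Letters.

Section WeilStructure.
Variables (F : fieldType) (g : lieAlgebra F) (W : weilAlgebra g).
Local Notation D := (weil_gda W).
Local Notation WS := (gda_super D).

Definition lgen (a : letter g) : W := generator W (letter_val a).

Lemma homog_generator v : homog D v.1 (generator W v).
Proof.
by case: v => [[] mu]; [apply: weil_odd_homog | apply: weil_even_homog].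
Qed.

Lemma homog_lgen a : homog D a.1 (lgen a).
Proof. exact: (homog_generator (letter_val a)). Qed.

Lemma generatorE v : generator W v = \sum_a letter_coef v a *: lgen a.
Proof.
case: v => [[] mu]; first by rewrite (@sum_letter_coef _ _ _ _ _ _ (weil_odd W)).
by rewrite (@sum_letter_coef _ _ _ _ _ _ (weil_even W)).
Qed.

Lemma weil_ind (P : W -> Prop) :
    (forall a x y, P x -> P y -> P (a *: x + y)) ->
    P 1 -> (forall a x, P x -> P (lgen a * x)) ->
  forall x, P x.
Proof.
move=> PL P1 Pl x; rewrite -[x]mulr1.
have P0 : P 0 by rewrite -[0](addNr 1) -scaleN1r; apply: PL.
have PZ a y : P y -> P (a *: y) by move=> Py; rewrite -[_ *: _]addr0; apply: PL.
have PD y z : P y -> P z -> P (y + z) by move=> Py; rewrite -[y]scale1r; apply: PL.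
have Pgen v y : P y -> P (generator W v * y).
  move=> Py; rewrite generatorE mulr_suml; elim/big_ind: _ => // a _.
  by rewrite -scalerAl; apply/PZ/Pl.
(* The statement that [P z] implies [P (x * z)] for all [z] is stable under products in [x], unlike
   [P] itself. *)
elim: (weil_generated x) 1 P1 => {x} [mu|mu|a|x y _ IHx _ IHy|x y _ IHx _ IHy] z Pz.
- exact: (Pgen (true, mu)).
- exact: (Pgen (false, mu)).
- by rewrite mulr_algl; apply: PZ.
- by rewrite mulrDl; apply: PD; [apply: IHx | apply: IHy].
by rewrite -mulrA; apply/IHx/IHy.
Qed.

Definition word (s : seq (letter g)) : W := \prod_(a <- s) lgen a.

Lemma word_cons a s : word (a :: s) = lgen a * word s.
Proof. exact: big_cons. Qed.

Lemma weil_word_ind (P : W -> Prop) :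
    (forall a x y, P x -> P y -> P (a *: x + y)) -> (forall s, P (word s)) ->
  forall x, P x.
Proof.
move=> PL Pw x; elim/weil_ind: x P PL Pw => [a x y IHx IHy||a x IHx] P PL Pw.
- exact: PL (IHx P PL Pw) (IHy P PL Pw).
- by have := Pw [::]; rewrite /word big_nil.
(* [P] was left general in the induction so that the letter can be absorbed into it. *)
apply: (IHx (fun y => P (lgen a * y))) => [b y z|s].
  by rewrite mulrDr -scalerAr; apply: PL.
by rewrite -word_cons.
Qed.

Lemma weil_linear_eq (V : lmodType F) (f h : {linear W -> V}) :
  (forall s, f (word s) = h (word s)) -> f =1 h.
Proof. by move=> fh; elim/weil_word_ind => // a x y; rewrite !linearP => -> ->. Qed.

(** The universal property is applied to the ground field placed in even degree, with every
    generator sent to zero. *)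
Lemma augmentation_exists : exists e : {linear W -> F^o},
  [/\ forall x, homog D true x -> e x = 0, e 1 = 1 &
      forall v x, e (generator W v * x) = 0].
Proof.
pose hom (i : bool) (x : F^o) := i -> x = 0.
have homD (x : F^o) : exists x0 x1, [/\ hom false x0, hom true x1 & x = x0 + x1].
  by exists x, 0; split; rewrite ?addr0.
have homL i a x y : hom i x -> hom i y -> hom i (a *: x + y).
  by case: i => // hx hy _; rewrite hx // hy // scaler0 addr0.
pose G : grading F^o := @Grading F F^o hom (fun _ _ => erefl) homL homD
  (fun x _ h => h isT).
have GS : super_algebra G.
  split=> // -[] [] x y hx hy //= _; first by rewrite hx ?mul0r.
  by rewrite hy ?mulr0.
have GC : super_commutative G.
  move=> [] [] x y hx hy; rewrite ?expr0 ?scale1r; try exact: mulrC.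
  by rewrite hx // mul0r mulr0 scaler0.
have [e [e_homog e_od e_ev] _] := @weil_free _ _ W F^o G GS GC \0 \0
  (fun _ => homog0 G true) (fun _ => homog0 G false).
have eg v : e (generator W v) = 0.
  by case: v => [[] mu]; [apply: e_od | apply: e_ev].
exists e; split=> [x hx||v x]; first exact: e_homog hx isT.
  exact: rmorph1.
by rewrite [LHS]rmorphM [X in X * _]eg mul0r.
Qed.

Definition augmentation := projT1 (cid augmentation_exists).

Lemma augmentation_odd x : homog D true x -> augmentation x = 0.
Proof. by rewrite /augmentation; case: cid => e /= [e0 _ _]; apply: e0. Qed.

Lemma augmentation1 : augmentation 1 = 1.
Proof. by rewrite /augmentation; case: cid => e /= []. Qed.

Lemma augmentation_generator v x : augmentation (generator W v * x) = 0.
Proof. by rewrite /augmentation; case: cid => e /= []. Qed.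

(** An algebra morphism from [W] to [W[e]] lifting the identity has the form [x + e d x] with [d] a
    derivation of parity [a.1], and the universal property allows the values of [d] on generators to
    be prescribed. *)
Lemma partial_exists a : exists d : {linear W -> W},
  [/\ op_parity D a.1 d, super_derivation D a.1 d &
      forall v, d (generator W v) = (letter_coef v a)%:A].
Proof.
pose B := sqz_ext WS a.1; pose G : grading B := sqz_grading WS a.1.
pose f mu : B := (weil_odd W mu, (letter_coef (true, mu) a)%:A).
pose h mu : B := (weil_even W mu, (letter_coef (false, mu) a)%:A).
have fL : linear f.
  move=> c mu nu; rewrite /f linearP letter_coef_linear scalerDl.
  by rewrite -[(_ *: _ : F^o) *: 1]scalerA.
have hL : linear h.
  move=> c mu nu; rewrite /h linearP letter_coef_linear scalerDl.
  by rewrite -[(_ *: _ : F^o) *: 1]scalerA.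
pose fM : {linear dual g -> B} := HB.pack f (GRing.isLinear.Build F (dual g) B _ f fL).
pose hM : {linear dual g -> B} := HB.pack h (GRing.isLinear.Build F (dual g) B _ h hL).
have h1 := homog1 WS.
have f_homog mu : homog G true (fM mu).
  split; first exact: weil_odd_homog.
  rewrite /= /letter_coef /=; case: (a.1); first exact: homogZ.
  by rewrite mul0r scale0r; apply: homog0.
have h_homog mu : homog G false (hM mu).
  split; first exact: weil_even_homog.
  rewrite /= /letter_coef /=; case: (a.1); last exact: homogZ.
  by rewrite mul0r scale0r; apply: homog0.
have [p [p_homog p_od p_ev] _] := @weil_free _ _ W B G (sqz_super WS a.1)
  (@sqz_super_commutative _ _ _ WS a.1 (@weil_super_commutative _ _ W))
  fM hM f_homog h_homog.
(* That the morphism lifts the identity is known on generators, hence everywhere. *)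
have p1 x : (p x).1 = x.
  elim: (weil_generated x) => [mu|mu|c|y z _ IHy _ IHz|y z _ IHy _ IHz].
  - by rewrite p_od.
  - by rewrite p_ev.
  - by rewrite linearZ rmorph1.
  - by rewrite linearD -[in RHS]IHy -[in RHS]IHz.
  by rewrite rmorphM -[in RHS]IHy -[in RHS]IHz.
have dL : linear (fun x => (p x).2 : W) by move=> c x y; rewrite linearP.
pose d : {linear W -> W} :=
  HB.pack (fun x => (p x).2 : W) (GRing.isLinear.Build F W W _ _ dL).
exists d; split=> [i x /p_homog [] //|i x y hx|[[] mu]].
- rewrite /d /= rmorphM.
  have -> u v : (u * v : B).2 = u.2 * v.1 + ginv D a.1 u.1 * v.2 by [].
  by rewrite !p1 (ginv_homog a.1 hx) -scalerAl.
- by rewrite /d /= p_od.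
by rewrite /d /= p_ev.
Qed.

Definition partial (a : letter g) : {linear W -> W} :=
  projT1 (cid (partial_exists a)).

Lemma partial_parity a : op_parity D a.1 (partial a).
Proof. by rewrite /partial; case: cid => d /= []. Qed.

Lemma partial_derivation a : super_derivation D a.1 (partial a).
Proof. by rewrite /partial; case: cid => d /= []. Qed.

Lemma partial_generator a v : partial a (generator W v) = (letter_coef v a)%:A.
Proof. by rewrite /partial; case: cid => d /= []. Qed.

Lemma partial1 a : partial a 1 = 0.
Proof. exact: derivation1 (partial_derivation a). Qed.

Lemma partial_generatorM a v x : partial a (generator W v * x) =
  letter_coef v a *: x + (-1) ^+ (a.1 && v.1) *: (generator W v * partial a x).
Proof.
rewrite (partial_derivation _ _ (homog_generator v)) partial_generator.
by rewrite mulr_algl.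
Qed.

Lemma partial_lgenM a b x : partial a (lgen b * x) =
  (b == a)%:R *: x + (-1) ^+ (a.1 && b.1) *: (lgen b * partial a x).
Proof. by rewrite partial_generatorM letter_coef_val. Qed.

End WeilStructure.

Lemma pchar0_natf_neq0 (F : fieldType) n : [pchar F] =i pred0 -> n.+1%:R != 0 :> F.
Proof. by move/pcharf0P => ->. Qed.

(** * The coadjoint action in a basis *)

Section Coadjoint.
Variables (F : fieldType) (g : lieAlgebra F).

Fact bracket_is_linear (x : g) : linear (bracket x).
Proof. exact: bracket_linear_r. Qed.

HB.instance Definition _ (x : g) :=
  GRing.isLinear.Build F g g _ (bracket x) (bracket_is_linear x).

Lemma bracket_anti (x y : g) : bracket x y = - bracket y x.
Proof.
apply/eqP; rewrite -addr_eq0; have := bracket_alternating (x + y).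
rewrite linearD /= -[x in bracket (x + y) x]scale1r -[x in bracket _ _ + bracket (x + y) y]scale1r.
by rewrite !bracket_linear_l !scale1r !bracket_alternating add0r addr0 addrC => ->.
Qed.

Fact coad_linear (x : g) : linear (coad x).
Proof.
by move=> a mu nu; apply/lfunP => z; rewrite add_lfunE scale_lfunE !coadE add_lfunE scale_lfunE.
Qed.

HB.instance Definition _ (x : g) :=
  GRing.isLinear.Build F (dual g) (dual g) _ (coad x) (coad_linear x).

Lemma coad_linear_l (mu : dual g) : linear (fun y : g => coad y mu).
Proof.
move=> a x y; apply/lfunP => z; rewrite add_lfunE scale_lfunE !coadE.
by rewrite bracket_linear_l linearP.
Qed.

Lemma coad_basis (x : g) (mu : dual g) :
  coad x mu = \sum_i (dual_basis i : 'Hom(g, F^o)) x *: coad (lie_basis i) mu.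
Proof.
pose c (y : g) := coad y mu.
pose cL : {linear g -> dual g} := HB.pack c (GRing.isLinear.Build F g (dual g) _ _ (coad_linear_l mu)).
rewrite {1}(lie_basis_expand x) -[LHS]/(cL _) linear_sum.
by apply: eq_bigr => i _; rewrite linearZ.
Qed.

End Coadjoint.

(** * Horizontal and basic elements *)

Section HorizontalElements.
Variables (F : fieldType) (charF0 : [pchar F] =i pred0).
Variables (g : lieAlgebra F) (W : weilAlgebra g).
Local Notation D := (weil_gda W).
Local Notation WS := (gda_super D).
Local Notation od i := (weil_odd W (dual_basis i)).

Lemma weil_contr_oddM xi mu w : contr D xi (weil_odd W mu * w) =
  ((mu : 'Hom(g, F^o)) xi : F) *: w - weil_odd W mu * contr D xi w.
Proof.
rewrite (contr_derivation D _ _ _ (weil_odd_homog _ _)) weil_contr_odd.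
by rewrite mulr_algl scaleN1r.
Qed.

(** The factor 1/2 is needed because contraction with [xi] hits both factors, and by antisymmetry of
    the bracket each yields one half of [- coad xi mu]. *)
Definition weil_lambda (mu : dual g) : W :=
  \sum_i od i * weil_odd W (- 2%:R^-1 *: coad (lie_basis i) mu).

Lemma weil_lambdaP mu : is_lambda mu (weil_lambda mu).
Proof.
split; first by exists (\dim {:g}), (@dual_basis _ g),
  (fun i => - 2%:R^-1 *: coad (lie_basis i) mu).
move=> xi; rewrite linear_sum /=.
under eq_bigr => i _ do rewrite weil_contr_oddM weil_contr_odd -scalerAr mulr1.
rewrite sumrB.
have -> : \sum_i ((dual_basis i : 'Hom(g, F^o)) xi : F) *:
    weil_odd W (- 2%:R^-1 *: coad (lie_basis i) mu) =
    - 2%:R^-1 *: weil_odd W (coad xi mu).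
  rewrite (coad_basis xi) linear_sum scaler_sumr; apply: eq_bigr => i _.
  by rewrite !linearZ /= !scalerA mulrC.
have -> : \sum_i ((- 2%:R^-1 *: coad (lie_basis i) mu : 'Hom(g, F^o)) xi : F) *:
    od i = 2%:R^-1 *: weil_odd W (coad xi mu).
  rewrite (dual_basis_expand (coad xi mu)) linear_sum scaler_sumr.
  apply: eq_bigr => i _; rewrite linearZ /= !scalerA scale_lfunE !coadE.
  by rewrite bracket_anti linearN scaleNr scalerN opprK.
rewrite scaleNr -opprD -scalerDl -[_^-1]mul1r -mulrDl divff ?scale1r //.
exact: (@pchar0_natf_neq0 F 1).
Qed.

Definition weil_hat mu : W := weil_even W mu - weil_lambda mu.

Lemma homog_wedge2 (w : W) : in_wedge2 w -> homog D false w.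
Proof.
move=> [n [mu [nu ->]]]; apply: homog_sum => i _.
exact: (homogM WS (weil_odd_homog _ _) (weil_odd_homog _ _)).
Qed.

Lemma in_Sg_even (w : W) : in_Sg w -> homog D false w.
Proof.
elim=> [mu l [/homog_wedge2 hl _]|a|x y _ hx _ hy|x y _ hx _ hy].
- by apply: homogB; first exact: weil_even_homog.
- exact/homogZ/(homog1 WS).
- exact: homogD.
exact: (homogM WS hx hy).
Qed.

Lemma in_Sg_horizontal (w : W) : in_Sg w -> forall xi, contr D xi w = 0.
Proof.
move=> Sw xi; elim: Sw => [mu l [_ hl]|a|x y _ hx _ hy|x y _ hx _ hy].
- by rewrite linearB /= weil_contr_even hl subrr.
- by rewrite linearZ /= (derivation1 (contr_derivation D xi)) scaler0.
- by rewrite linearD /= hx hy addr0.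
exact: (derivation_ker (contr_derivation D xi) (contr_parity D xi)).
Qed.

(* The composite of these operators kills all left multiples of the [od i] and *)
(* fixes the horizontal elements; modulo such multiples, W is generated by the  *)
(* [weil_hat mu].                                                               *)
Definition horizontal_proj (i : 'I_(\dim {:g})) (w : W) : W :=
  w - od i * contr D (lie_basis i) w.

Definition horizontal_projs := foldr (fun i f => horizontal_proj i \o f) idfun.

Lemma horizontal_projs_linear s : linear (horizontal_projs s).
Proof.
elim: s => [|i s IHs] a x y //=; rewrite IHs /horizontal_proj linearP /=.
by rewrite mulrDr -scalerAr scalerBr opprD addrACA.
Qed.

Lemma horizontal_proj_odd_neq i j w : i != j ->
  horizontal_proj i (od j * w) = od j * horizontal_proj i w.
Proof.
move=> ij; rewrite /horizontal_proj weil_contr_oddM dual_basis_lie_basis.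
rewrite eq_sym (negPf ij) scale0r sub0r mulrN opprK mulrBr !mulrA.
rewrite (weil_super_commutative (weil_odd_homog _ _) (weil_odd_homog _ (dual_basis i))).
by rewrite expr1 scaleN1r mulNr opprK.
Qed.

Lemma horizontal_proj_odd_eq i w : horizontal_proj i (od i * w) = 0.
Proof.
rewrite /horizontal_proj weil_contr_oddM dual_basis_lie_basis eqxx scale1r.
have od2 : od i * od i = 0.
  apply: (super_alternating _ (@weil_super_commutative _ _ W)).
    exact: (@pchar0_natf_neq0 F 1).
  exact: weil_odd_homog.
by rewrite mulrBr mulrA od2 mul0r subr0 subrr.
Qed.

Lemma horizontal_projs_odd_notin s j w : j \notin s ->
  horizontal_projs s (od j * w) = od j * horizontal_projs s w.
Proof.
elim: s => //= i s IHs; rewrite inE negb_or eq_sym => /andP[ij js].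
by rewrite IHs // horizontal_proj_odd_neq.
Qed.

Lemma horizontal_projs_odd s j w : j \in s -> horizontal_projs s (od j * w) = 0.
Proof.
elim: s => //= i s IHs; rewrite inE.
have [/IHs -> _|js] := boolP (j \in s).
  by rewrite /horizontal_proj linear0 mulr0 subr0.
rewrite orbF => /eqP <-.
by rewrite horizontal_projs_odd_notin // horizontal_proj_odd_eq.
Qed.

Lemma weil_hat_Sg mu : in_Sg (weil_hat mu).
Proof. exact/Sg_hat/weil_lambdaP. Qed.

Lemma horizontal_projs_hat s mu w :
  horizontal_projs s (weil_hat mu * w) = weil_hat mu * horizontal_projs s w.
Proof.
have Sh := weil_hat_Sg mu; have hh := in_Sg_even Sh.
elim: s => //= i s ->; rewrite /horizontal_proj.
rewrite (contr_derivation D _ _ _ hh) (in_Sg_horizontal Sh) mul0r add0r andbF scale1r.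
rewrite mulrBr !mulrA; congr (_ - _ * _).
by rewrite (weil_super_commutative (weil_odd_homog _ _) hh) scale1r.
Qed.

Lemma horizontal_projs_Sg w : in_Sg (horizontal_projs (enum 'I_(\dim {:g})) w).
Proof.
set s := enum _; have P_linear := horizontal_projs_linear s.
pose P : {linear W -> W} := HB.pack (horizontal_projs s)
  (GRing.isLinear.Build F W W _ _ P_linear).
have P_odd i x : P (od i * x) = 0 by apply: horizontal_projs_odd; rewrite mem_enum.
rewrite -[horizontal_projs s w]/(P w).
elim/(weil_ind (W := W)): w => [a x y Sx Sy||[[] i] x Sx].
- rewrite linearP -mulr_algl; apply: Sg_add Sy.
  exact: Sg_mul (Sg_scalar W a) Sx.
- suff -> : P 1 = 1%:A by apply: Sg_scalar.
  rewrite scale1r /P /=; elim: (s) => //= i s' ->.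
  by rewrite /horizontal_proj (derivation1 (contr_derivation D _)) mulr0 subr0.
- rewrite P_odd -[0](scale0r 1); exact: Sg_scalar.
(* An even letter is [weil_hat + weil_lambda]: the hat can be pulled out of the projection, while
   [weil_lambda] is a sum of left multiples of odd letters, which are killed. *)
rewrite -[lgen W _](subrK (weil_lambda (dual_basis i))) mulrDl linearD.
rewrite [P (_ * _)](horizontal_projs_hat s) mulr_suml linear_sum big1 => [|j _].
  by rewrite addr0; apply: Sg_mul => //; apply: weil_hat_Sg.
by rewrite -mulrA P_odd.
Qed.

Lemma horizontal_in_Sg w : (forall xi, contr D xi w = 0) -> in_Sg w.
Proof.
move=> hw; suff <- : horizontal_projs (enum 'I_(\dim {:g})) w = w.
  exact: horizontal_projs_Sg.
by elim: (enum _) => //= i s ->; rewrite /horizontal_proj hw mulr0 subr0.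
Qed.

Lemma basic_in_Sg_inv w : basic D w <-> in_Sg_inv w.
Proof.
split=> [bw|[Sw lw] xi]; last by rewrite lw in_Sg_horizontal.
by split=> [|xi]; [apply: horizontal_in_Sg => xi | ]; have [] := bw xi.
Qed.

Lemma basic_even w : basic D w -> homog D false w.
Proof. by case/basic_in_Sg_inv => Sw _; apply: in_Sg_even. Qed.

(* Basic elements are even, and [dif] preserves basic elements while being odd. *)
Lemma dif_basic w : basic D w -> dif D w = 0.
Proof.
move=> bw; apply: (homog_disjoint D); first exact/basic_even/basic_dif.
exact: (dif_parity D _ (basic_even bw)).
Qed.

End HorizontalElements.

(** * Commutators of derivations *)

Section Derivations.
Variables (F : fieldType) (A : algType F) (G : grading A).

(** Only terms with nonzero coefficient are required to have parity [p]: in the applications the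
    coefficients vanish on letters of the wrong parity. *)
Lemma sum_derivation p (I : finType) (f : I -> A -> A) (c : I -> F) :
    (forall k, c k != 0 -> super_derivation G p (f k)) ->
  super_derivation G p (fun x => \sum_k c k *: f k x).
Proof.
move=> df i x y hx; rewrite mulr_suml mulr_sumr scaler_sumr -big_split /=.
apply: eq_bigr => k _; have [->|/df/(_ _ _ y hx) ->] := eqVneq (c k) 0.
  by rewrite !scale0r mul0r mulr0 scaler0 addr0.
by rewrite scalerDr -scalerAl -scalerAr !scalerA [c k * _]mulrC.
Qed.

Lemma scomm_derivation p q (P Q : {linear A -> A}) :
    op_parity G p P -> op_parity G q Q ->
    super_derivation G p P -> super_derivation G q Q ->
  super_derivation G (p (+) q) (scomm p q P Q).
Proof.
move=> PP PQ dP dQ i x y hx; rewrite /scomm [in RHS]mulrBl [in RHS]mulrBr.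
rewrite (dP _ _ _ hx) (dQ _ _ _ hx) !linearD !linearZ /=.
rewrite (dP _ _ _ hx) (dQ _ _ _ hx) (dP _ _ _ (PQ _ _ hx)) (dQ _ _ _ (PP _ _ hx)).
have shuffle (V : zmodType) (a b c d a' d' : V) :
    a + b + (c + d) - (a' + c + (b + d')) = a - a' + (d - d').
  have -> : a + b + (c + d) = b + c + (a + d) by rewrite (addrC a b) addrACA.
  have -> : a' + c + (b + d') = b + c + (a' + d').
    by rewrite (addrC a' c) addrACA (addrC c b).
  by rewrite [- (b + c + _)]opprD addrACA subrr add0r opprD addrACA.
rewrite !(scalerDr, scalerN) -scalerAl -scalerAr !(scalerDr, scalerN, scalerA).
rewrite -!signr_addb.
have -> : p && q (+) q && (p (+) i) = q && i by case: (p) (q) (i) => [] [] [].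
have -> : p && q (+) p && i = p && (q (+) i) by case: (p) (q) (i) => [] [] [].
rewrite -[- _ - _]opprD shuffle; congr (_ - _ + (_ *: _ - _ *: _));
  by congr (_ ^+ nat_of_bool _); case: (p) (q) (i) => [] [] [].
Qed.

End Derivations.

Section WeilDerivations.
Variables (F : fieldType) (g : lieAlgebra F) (W : weilAlgebra g).
Local Notation D := (weil_gda W).
Local Notation WS := (gda_super D).

Lemma weil_derivation_eq p (P Q : {linear W -> W}) :
    super_derivation D p P -> super_derivation D p Q ->
    (forall a, P (lgen W a) = Q (lgen W a)) ->
  P =1 Q.
Proof.
move=> dP dQ PQ; elim/weil_ind => [a x y ex ey||a x ex].
- by rewrite !linearP ex ey.
- by rewrite (derivation1 dP) (derivation1 dQ).
by rewrite (dP _ _ _ (homog_lgen W a)) (dQ _ _ _ (homog_lgen W a)) PQ ex.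
Qed.

Lemma scomm_linear p q (P Q : {linear W -> W}) : linear (scomm p q P Q).
Proof.
move=> a x y; rewrite /scomm.
have -> : P (Q (a *: x + y)) = a *: P (Q x) + P (Q y) by rewrite !linearP.
have -> : Q (P (a *: x + y)) = a *: Q (P x) + Q (P y) by rewrite !linearP.
by rewrite scalerDr opprD addrACA scalerBr !scalerA [_ * a]mulrC.
Qed.

Lemma sum_op_linear (V : lmodType F) (I : finType) (f : I -> {linear W -> V})
  (c : I -> F) : linear (fun x => \sum_i c i *: f i x).
Proof.
move=> a x y; rewrite scaler_sumr -big_split; apply: eq_bigr => i _ /=.
by rewrite linearP scalerDr !scalerA mulrC.
Qed.

Lemma partial_lgen a b : partial W a (lgen W b) = (b == a)%:R%:A.
Proof. by rewrite partial_generator letter_coef_val. Qed.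

(** The super commutator of two partial derivatives is a derivation, and it kills every letter
    because first derivatives of letters are scalars. *)
Lemma partial_comm a b x :
  partial W a (partial W b x) =
  (-1) ^+ (a.1 && b.1) *: partial W b (partial W a x).
Proof.
pose P : {linear W -> W} := HB.pack (scomm a.1 b.1 (partial W a) (partial W b))
  (GRing.isLinear.Build F W W _ _ (scomm_linear a.1 b.1 _ _)).
apply/eqP; rewrite -subr_eq0; apply/eqP; rewrite -[LHS]/(P x).
have dP : super_derivation D (a.1 (+) b.1) P.
  apply: scomm_derivation;
    by [apply: partial_parity | apply: partial_derivation].
have d0 : super_derivation D (a.1 (+) b.1) (\0).
  by move=> i y z _ /=; rewrite mul0r mulr0 scaler0 addr0.
apply: (weil_derivation_eq dP d0) => c.
rewrite /P /= /scomm /= !partial_lgen !linearZ /= !partial1.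
by rewrite oppr0 !scaler0 addr0.
Qed.

(* [c] and [v] record the value of an odd or even derivation [T] on letters: *)
(* the constant term and the generator occurring in it.                      *)
Record generator_derivation (p : bool) (T : {linear W -> W})
    (c : letter g -> F) (v : letter g -> bool * dual g) : Prop := {
  gd_parity : op_parity D p T;
  gd_derivation : super_derivation D p T;
  gd_coef : forall a, c a != 0 -> a.1 = p;
  gd_gen : forall a, (v a).1 = p (+) a.1;
  gd_lgen : forall a, T (lgen W a) = (c a)%:A + generator W (v a)
}.

(** For [c] the constant terms of a derivation [T], this is the part of [T] that shortens words by
    one letter; the rest of [T] preserves their length. *)
Definition const_part (c : letter g -> F) (x : W) : W :=
  \sum_a c a *: partial W a x.

Definition euler (x : W) : W := \sum_a lgen W a * partial W a x.

Fact euler_linear : linear euler.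
Proof.
move=> a x y; rewrite scaler_sumr -big_split; apply: eq_bigr => i _ /=.
by rewrite linearP mulrDr scalerAr.
Qed.
HB.instance Definition _ := GRing.isLinear.Build F W W _ euler euler_linear.

HB.instance Definition _ c :=
  GRing.isLinear.Build F W W _ (const_part c) (sum_op_linear (partial W) c).

Lemma euler_parity : op_parity D false euler.
Proof.
move=> i x hx; apply: homog_sum => a _ /=.
have := homogM WS (homog_lgen W a) (partial_parity a hx).
by rewrite addbA addbb.
Qed.

Lemma euler_derivation : super_derivation D false euler.
Proof.
move=> i x y hx; rewrite /euler mulr_suml mulr_sumr scale1r -big_split.
apply: eq_bigr => a _ /=; rewrite (partial_derivation _ _ hx) mulrDr mulrA.
congr (_ + _); rewrite -scalerAr !mulrA.
rewrite (weil_super_commutative (homog_lgen W a) hx) -scalerAl scalerA -signr_addb.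
by rewrite addbb scale1r.
Qed.

Lemma euler1 : euler 1 = 0.
Proof. exact: (derivation1 euler_derivation). Qed.

Lemma euler_lgen a : euler (lgen W a) = lgen W a.
Proof.
rewrite /euler (bigD1 a) //= big1 => [|b ba]; rewrite partial_lgen.
  by rewrite eqxx scale1r mulr1 addr0.
by rewrite eq_sym (negPf ba) scale0r mulr0.
Qed.

Lemma euler_generator v : euler (generator W v) = generator W v.
Proof.
rewrite generatorE linear_sum; apply: eq_bigr => a _.
by rewrite linearZ /= euler_lgen.
Qed.

Section GeneratorDerivation.
Variables (p : bool) (T : {linear W -> W}) (c : letter g -> F).
Variables (v : letter g -> bool * dual g).
Hypothesis gdT : generator_derivation p T c v.

Let T1 : T 1 = 0. Proof. exact: derivation1 (gd_derivation gdT). Qed.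

(** The super commutator of [partial W b] with [T] and the sum on the right are derivations of the
    same parity. On letters the constants of [T] are differentiated away, and both give the
    coefficient of [b] in the linear part. *)
Lemma partial_derivation_comm b x :
  partial W b (T x) =
  (-1) ^+ (p && b.1) *: T (partial W b x) +
  \sum_a letter_coef (v a) b *: partial W a x.
Proof.
pose P : {linear W -> W} := HB.pack (scomm b.1 p (partial W b) T)
  (GRing.isLinear.Build F W W _ _ (scomm_linear b.1 p _ _)).
pose Q : {linear W -> W} :=
  HB.pack (fun x => \sum_a letter_coef (v a) b *: partial W a x)
  (GRing.isLinear.Build F W W _ _ (sum_op_linear (partial W) _)).
apply/eqP; rewrite addrC -subr_eq andbC; apply/eqP.
rewrite -[LHS]/(P x) -[RHS]/(Q x).
have dP : super_derivation D (b.1 (+) p) P.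
  apply: scomm_derivation (partial_derivation b) (gd_derivation gdT).
    exact: partial_parity.
  exact: gd_parity gdT.
have dQ : super_derivation D (b.1 (+) p) Q.
  apply: sum_derivation => a; rewrite /letter_coef (gd_gen gdT).
  have [ab _|_] := eqVneq (p (+) a.1) b.1; last by rewrite mul0r eqxx.
  by rewrite -ab addbAC addbb; apply: partial_derivation.
apply: (weil_derivation_eq dP dQ) => a.
rewrite /P /Q /= /scomm partial_lgen [T (_ *: _)]linearZ /= T1 !scaler0 subr0.
rewrite (gd_lgen gdT) linearD [partial W b (_ *: _)]linearZ /=.
rewrite partial1 scaler0 add0r partial_generator.
rewrite (bigD1 a) //= big1 => [|d da]; rewrite partial_lgen.
  by rewrite eqxx scale1r addr0.
by rewrite eq_sym (negPf da) scale0r scaler0.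
Qed.

Lemma const_part_derivation : super_derivation D p (const_part c).
Proof.
by apply: sum_derivation => a /(gd_coef gdT) <-; apply: partial_derivation.
Qed.

Lemma const_part_lgen a : const_part c (lgen W a) = (c a)%:A.
Proof.
rewrite /const_part (bigD1 a) //= big1 => [|d da]; rewrite partial_lgen.
  by rewrite eqxx scale1r addr0.
by rewrite eq_sym (negPf da) scale0r scaler0.
Qed.

Lemma partial_const_part b x :
  partial W b (const_part c x) =
  (-1) ^+ (p && b.1) *: const_part c (partial W b x).
Proof.
rewrite /const_part linear_sum scaler_sumr; apply: eq_bigr => a _.
rewrite linearZ /= partial_comm !scalerA; have [->|/(gd_coef gdT) <-] := eqVneq (c a) 0.
  by rewrite mul0r mulr0.
by rewrite mulrC andbC.
Qed.

(** [euler] counts letters, and only the constant part of [T] changes their number, lowering it by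
    one. *)
Lemma euler_derivation_comm x : T (euler x) = euler (T x) + const_part c x.
Proof.
pose P : {linear W -> W} := HB.pack (scomm p false T euler)
  (GRing.isLinear.Build F W W _ _ (scomm_linear p false _ _)).
apply/eqP; rewrite addrC -subr_eq; apply/eqP.
have -> : T (euler x) - euler (T x) = P x by rewrite /P /= /scomm andbF scale1r.
have dP : super_derivation D p P.
  have := scomm_derivation (gd_parity gdT) euler_parity
    (gd_derivation gdT) euler_derivation.
  by rewrite addbF.
apply: (weil_derivation_eq dP const_part_derivation) => a.
rewrite /P /= const_part_lgen /scomm andbF scale1r euler_lgen (gd_lgen gdT).
by rewrite linearD linearZ /= euler1 scaler0 add0r euler_generator addrK.
Qed.

Lemma augmentation_derivation x :
  augmentation W (T x) = \sum_a c a *: augmentation W (partial W a x).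
Proof.
elim/weil_ind: x => [a x y ex ey||b x ex].
- rewrite 2!linearP ex ey scaler_sumr -big_split; apply: eq_bigr => d _ /=.
  by rewrite 2!linearP /= scalerDr !scalerA [a * _]mulrC.
- by rewrite T1 linear0 big1 // => a _; rewrite partial1 linear0 scaler0.
rewrite (gd_derivation gdT _ (homog_lgen W b)) (gd_lgen gdT) mulrDl mulr_algl.
rewrite !linearD !linearZ /= !augmentation_generator addr0 scaler0 addr0.
rewrite (bigD1 b) //= big1 => [|a ab]; rewrite partial_lgenM linearD !linearZ /=.
  by rewrite augmentation_generator eqxx scale1r scaler0 !addr0.
by rewrite augmentation_generator eq_sym (negPf ab) scale0r scaler0 addr0 scaler0.
Qed.

End GeneratorDerivation.

(** The zero differential of an even letter is coded as the odd generator of the zero functional. *)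
Definition dif_letter (a : letter g) : bool * dual g :=
  (~~ a.1, if a.1 then dual_basis a.2 else 0).

Lemma weil_dif_gd :
  generator_derivation true (dif D) (fun=> 0) dif_letter.
Proof.
split=> [||a|//|[[] i]]; rewrite ?eqxx ?scale0r ?add0r //.
- exact: dif_parity.
- exact: dif_derivation.
- exact: weil_dif_odd.
by rewrite [LHS]weil_dif_even /generator /= linear0.
Qed.

Definition contr_coef (xi : g) (a : letter g) : F :=
  a.1%:R * (dual_basis a.2 : 'Hom(g, F^o)) xi.

Definition contr_letter (xi : g) (a : letter g) : bool * dual g :=
  (~~ a.1, if a.1 then 0 else - coad xi (dual_basis a.2)).

Lemma weil_contr_gd xi :
  generator_derivation true (contr D xi) (contr_coef xi) (contr_letter xi).
Proof.
split=> [||[[] i]|//|[[] i]]; rewrite /contr_coef ?mul1r ?mul0r ?eqxx ?scale0r ?add0r //.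
- exact: contr_parity.
- exact: contr_derivation.
- by rewrite [LHS]weil_contr_odd [X in _ + X]linear0 addr0.
by rewrite [LHS]weil_contr_even /generator /= linearN.
Qed.

End WeilDerivations.

(** * The symmetrization map *)

Section SymmetrizationMap.
Variables (F : fieldType) (charF0 : [pchar F] =i pred0).
Variables (g : lieAlgebra F) (W : weilAlgebra g).
Variables (A : algType F) (D : gdAlgebra g A) (theta : connection D).
Local Notation DW := (weil_gda W).
Local Notation ph a := (phi theta (letter_val a)).

Lemma homog_phi v : homog D v.1 (phi theta v).
Proof.
case: v => [[] mu]; first exact: conn_odd.
exact: (dif_parity D _ (conn_odd theta mu)).
Qed.

Lemma phiE v : phi theta v = \sum_a letter_coef v a *: ph a.
Proof.
case: v => [[] mu]; first by rewrite (@sum_letter_coef _ _ _ _ _ _ theta).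
by rewrite (@sum_letter_coef _ _ _ _ _ _ (dif D \o theta)).
Qed.

(* On a word of length [k] this is the unnormalized symmetrization, and it *)
(* vanishes on all words of any other length.                              *)
Fixpoint sym_part (k : nat) (w : W) : A :=
  if k is j.+1 then \sum_a ph a * sym_part j (partial W a w)
  else (augmentation W w : F) *: 1.

Fact sym_part_linear k : linear (sym_part k).
Proof.
elim: k => [|k IHk] a x y /=.
  by rewrite linearP /= scalerDl -scalerA.
rewrite scaler_sumr -big_split; apply: eq_bigr => i _ /=.
by rewrite linearP IHk mulrDr scalerAr.
Qed.
HB.instance Definition _ k :=
  GRing.isLinear.Build F W A _ (sym_part k) (sym_part_linear k).

Lemma homog_sym_part k i w : homog DW i w -> homog D i (sym_part k w).
Proof.
elim: k i w => [|k IHk] i w hw /=.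
  case: i hw => [/augmentation_odd ->|_]; first by rewrite scale0r; apply: homog0.
  exact/homogZ/(homog1 (gda_super D)).
apply: homog_sum => a _; have := IHk _ _ (partial_parity a hw).
by move/(homogM (gda_super D) (homog_phi (letter_val a))); rewrite addbA addbb.
Qed.

Lemma sym_partS k w : sym_part k.+1 w = \sum_a ph a * sym_part k (partial W a w).
Proof. by []. Qed.

(** All [n]-fold derivatives vanish: this stands for a bound on the degree of [w] and makes the
    series defining [symmetrization] finite. *)
Fixpoint partial_nilpotent (n : nat) (w : W) : Prop :=
  if n is m.+1 then forall a, partial_nilpotent m (partial W a w) else w = 0.

Lemma partial_nilpotent_linear n a x y :
  partial_nilpotent n x -> partial_nilpotent n y -> partial_nilpotent n (a *: x + y).
Proof.
elim: n x y => [|n IHn] x y /= hx hy; first by rewrite hx hy scaler0 addr0.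
by move=> b; rewrite linearP; apply: IHn.
Qed.

Lemma partial_nilpotentS n x : partial_nilpotent n x -> partial_nilpotent n.+1 x.
Proof.
by elim: n x => [|n IHn] x hx a; [rewrite /= hx linear0 | apply/IHn/hx].
Qed.

Lemma partial_nilpotent_lgenM n b x :
  partial_nilpotent n x -> partial_nilpotent n.+1 (lgen W b * x).
Proof.
elim: n x => [|n IHn] x hx; first by move=> a; rewrite /= hx mulr0 linear0.
suff h a : partial_nilpotent n.+1 (partial W a (lgen W b * x)) by exact: h.
rewrite partial_lgenM; apply: partial_nilpotent_linear => //.
rewrite -[_ *: _]addr0; apply: partial_nilpotent_linear; first exact/IHn/hx.
by elim: n.+1 {IHn hx} => //= m IHm c; rewrite linear0.
Qed.

Lemma partial_nilpotent_leq m n x :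
  (m <= n)%N -> partial_nilpotent m x -> partial_nilpotent n x.
Proof.
by move=> /subnK <-; elim: (n - m)%N => // k IHk /IHk /partial_nilpotentS.
Qed.

Lemma partial_nilpotent_exists x : exists n, partial_nilpotent n x.
Proof.
elim/weil_ind: x => [a x y [m hx] [n hy]||a x [n hx]].
- exists (maxn m n); apply: partial_nilpotent_linear.
    exact: (partial_nilpotent_leq (leq_maxl m n) hx).
  exact: (partial_nilpotent_leq (leq_maxr m n) hy).
- by exists 1%N => a /=; rewrite partial1.
by exists n.+1; apply: partial_nilpotent_lgenM.
Qed.

Lemma sym_part_nilpotent n k x :
  partial_nilpotent n x -> (n <= k)%N -> sym_part k x = 0.
Proof.
elim: n k x => [k x -> _|n IHn [//|k] x hx nk]; first by rewrite linear0.
by rewrite sym_partS big1 // => a _; rewrite IHn ?mulr0.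
Qed.

Definition sym_bound (n : nat) (w : W) := forall k, (n <= k)%N -> sym_part k w = 0.

Lemma sym_bound_exists w : exists n, sym_bound n w.
Proof.
by have [n hn] := partial_nilpotent_exists w; exists n => k; apply: sym_part_nilpotent.
Qed.

Lemma sym_bound_leq m n w : (m <= n)%N -> sym_bound m w -> sym_bound n w.
Proof. by move=> mn hm k nk; apply/hm/(leq_trans mn). Qed.

(** The cut-off is chosen by [cid]; by [symmetrizationE] every other bound gives the same sum. *)
Definition symmetrization (w : W) : A :=
  \sum_(k < projT1 (cid (sym_bound_exists w))) k`!%:R^-1 *: sym_part k w.

Lemma symmetrizationE n w : sym_bound n w ->
  symmetrization w = \sum_(k < n) k`!%:R^-1 *: sym_part k w.
Proof.
have stable m p : sym_bound m w -> (m <= p)%N ->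
    \sum_(k < m) k`!%:R^-1 *: sym_part k w = \sum_(k < p) k`!%:R^-1 *: sym_part k w.
  move=> hm mp; rewrite -!(big_mkord predT (fun k => k`!%:R^-1 *: sym_part k w)).
  rewrite [RHS](big_cat_nat (n := m)) //= [X in _ + X]big_nat.
  rewrite [X in _ + X]big1 ?addr0 // => k /andP[mk _].
  by rewrite hm ?scaler0.
rewrite /symmetrization; case: cid => m /= hm hn.
rewrite (stable m (maxn m n)) ?leq_maxl //.
by rewrite (stable n (maxn m n)) ?leq_maxr.
Qed.

Fact symmetrization_linear : linear symmetrization.
Proof.
move=> a x y; have [m hx] := sym_bound_exists x; have [n hy] := sym_bound_exists y.
have hx' := sym_bound_leq (leq_maxl m n) hx.
have hy' := sym_bound_leq (leq_maxr m n) hy.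
rewrite (symmetrizationE hx') (symmetrizationE hy') (@symmetrizationE (maxn m n)).
  rewrite scaler_sumr -big_split; apply: eq_bigr => k _ /=.
  by rewrite linearP scalerDr !scalerA mulrC.
by move=> k mnk; rewrite linearP /= hx' ?hy' ?scaler0 ?addr0.
Qed.
HB.instance Definition _ :=
  GRing.isLinear.Build F W A _ symmetrization symmetrization_linear.

Lemma homog_symmetrization i w : homog DW i w -> homog D i (symmetrization w).
Proof. by move=> hw; apply: homog_sum => k _; apply/homogZ/homog_sym_part. Qed.

Lemma sym_part0 w : sym_part 0 w = (augmentation W w : F) *: 1.
Proof. by []. Qed.

Arguments sym_part : simpl never.

Section Intertwining.
Variables (p : bool) (T : {linear W -> W}) (c : letter g -> F).
Variables (v : letter g -> bool * dual g) (S : {linear A -> A}).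
Hypothesis gdT : generator_derivation p T c v.
Hypothesis dS : super_derivation D p S.
Hypothesis SphE : forall a, S (ph a) = (c a)%:A + phi theta (v a).

(** [T - const_part c] is the linear part of [T], matched factor by factor by [S]. A factor replaced
    by its constant leaves a shorter word, each arrangement of which arises from [k] positions of
    the deleted letter, hence the last term; at [k = 0] its coefficient is zero. *)
Lemma sym_part_intertwine k w :
  S (sym_part k w) = sym_part k (T w) - sym_part k (const_part c w)
    + k%:R *: sym_part k.-1 (const_part c w).
Proof.
have sym_const j x : sym_part j (const_part c x) =
    \sum_a c a *: sym_part j (partial W a x).
  by rewrite linear_sum; apply: eq_bigr => a _; rewrite linearZ.
elim: k w => [|k IHk] w.
  rewrite !sym_part0 scale0r addr0 linearZ /= (derivation1 dS) scaler0.
  rewrite (augmentation_derivation gdT) /const_part linear_sum /=.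
  rewrite -[X in X *: _ - _]/(\sum_a c a *: augmentation W (partial W a w) : F).
  under [X in _ - X *: _]eq_bigr do rewrite linearZ.
  by rewrite subrr.
have -> : S (sym_part k.+1 w) = \sum_a (c a *: sym_part k (partial W a w)
    + phi theta (v a) * sym_part k (partial W a w)
    + (-1) ^+ (p && a.1) *: (ph a * S (sym_part k (partial W a w)))).
  rewrite linear_sum; apply: eq_bigr => a _ /=.
  by rewrite (dS _ (homog_phi (letter_val a))) SphE mulrDl mulr_algl.
rewrite !big_split /= -sym_const.
have -> : sym_part k.+1 (T w) =
    \sum_a (-1) ^+ (p && a.1) *: (ph a * sym_part k (T (partial W a w)))
    + \sum_a phi theta (v a) * sym_part k (partial W a w).
  rewrite sym_partS.
  under eq_bigr => b _ do rewrite (partial_derivation_comm gdT) linearD linearZ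
    linear_sum /= mulrDr -scalerAr mulr_sumr.
  rewrite big_split /= exchange_big /=; congr (_ + _); apply: eq_bigr => a _.
  rewrite phiE mulr_suml; apply: eq_bigr => b _.
  by rewrite linearZ /= -scalerAr -scalerAl.
have kapE j : sym_part j.+1 (const_part c w) = \sum_a (-1) ^+ (p && a.1) *:
    (ph a * sym_part j (const_part c (partial W a w))).
  rewrite sym_partS; apply: eq_bigr => a _.
  by rewrite (partial_const_part gdT) linearZ /= -scalerAr.
rewrite kapE.
have -> : \sum_a (-1) ^+ (p && a.1) *: (ph a * S (sym_part k (partial W a w))) =
    \sum_a (-1) ^+ (p && a.1) *: (ph a * sym_part k (T (partial W a w)))
    - \sum_a (-1) ^+ (p && a.1) *: (ph a * sym_part k (const_part c (partial W a w)))
    + k%:R *: sym_part k (const_part c w).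
  case: (k) IHk kapE => [|j] IHk kapE.
    rewrite scale0r addr0 -sumrB; apply: eq_bigr => a _.
    by rewrite IHk scale0r addr0 mulrBr scalerBr.
  rewrite kapE scaler_sumr -sumrB -big_split; apply: eq_bigr => a _ /=.
  by rewrite IHk mulrDr mulrBr scalerDr scalerBr -scalerAr !scalerA mulrC.
rewrite -natr1 scalerDl scale1r.
set X := sym_part k _; set Y := \sum_a phi _ _ * _; set Z := \sum_a _ *: (_ * sym_part k (T _)).
set U := \sum_a _ *: _.
by rewrite [Z + Y - U]addrAC [RHS]addrACA addrC [X + Y]addrC.
Qed.

(** Since k/k! = 1/(k-1)!, the two sums over [const_part] differ by an index shift and cancel. The
    one unmatched term, at [N], is zero because [N] exceeds the bound for [const_part c w]. *)
Lemma symmetrization_intertwine w : S (symmetrization w) = symmetrization (T w).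
Proof.
have [l hw] := sym_bound_exists w; have [m hT] := sym_bound_exists (T w).
have [n hc] := sym_bound_exists (const_part c w).
pose N := maxn l (maxn m n).
have {}hw : sym_bound N.+1 w.
  by apply: sym_bound_leq hw; rewrite ltnW // ltnS leq_maxl.
have {}hT : sym_bound N.+1 (T w).
  apply: sym_bound_leq hT; rewrite ltnW // ltnS.
  by rewrite (leq_trans (leq_maxl m n)) // leq_maxr.
have hcN : sym_part N (const_part c w) = 0.
  by rewrite hc // (leq_trans (leq_maxr m n)) // leq_maxr.
rewrite (symmetrizationE hw) (symmetrizationE hT) linear_sum.
transitivity (\sum_(k < N.+1) (k`!%:R^-1 *: sym_part k (T w)) -
  \sum_(k < N.+1) (k`!%:R^-1 *: sym_part k (const_part c w)) +
  \sum_(k < N.+1) (k`!%:R^-1 *: (k%:R *: sym_part k.-1 (const_part c w)))).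
  rewrite -sumrB -big_split; apply: eq_bigr => k _ /=.
  by rewrite linearZ /= sym_part_intertwine scalerDr scalerBr.
rewrite [X in _ - X]big_ord_recr /= hcN scaler0 addr0.
rewrite [X in _ + X]big_ord_recl /= scale0r scaler0 add0r -addrA addrC.
rewrite -[RHS]add0r; congr (_ + _); rewrite addrC -sumrB big1 // => k _ /=.
rewrite /bump /= add1n factS natrM invfM scalerA mulrAC mulVf ?mul1r ?subrr //.
exact: pchar0_natf_neq0.
Qed.

End Intertwining.

Lemma symmetrization_dif w : symmetrization (dif DW w) = dif D (symmetrization w).
Proof.
apply/esym/(symmetrization_intertwine (weil_dif_gd W) (dif_derivation D)).
by case=> [[] i]; rewrite scale0r add0r /phi /= ?linear0 ?dif_dif.
Qed.

Lemma symmetrization_contr xi w :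
  symmetrization (contr DW xi w) = contr D xi (symmetrization w).
Proof.
apply/esym/(symmetrization_intertwine (weil_contr_gd W xi) (contr_derivation D xi)).
case=> [[] i]; rewrite /phi /contr_coef /=.
  by rewrite conn_contr mul1r !linear0 addr0.
(* By Cartan's formula the contraction of [d theta] is the Lie derivative of [theta], since [d]
   kills the scalar obtained by contracting [theta]. *)
rewrite mul0r scale0r add0r linearN -conn_lie -(dif_contr D) /scomm /=.
rewrite conn_contr linearZ /= (derivation1 (dif_derivation D)) scaler0 sub0r.
by rewrite expr1 scaleN1r opprK.
Qed.

Lemma symmetrization_lie xi w :
  symmetrization (lie DW xi w) = lie D xi (symmetrization w).
Proof.
rewrite -(dif_contr DW) -(dif_contr D) /scomm linearB linearZ /=.
by rewrite !(symmetrization_dif, symmetrization_contr).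
Qed.

Definition symmetrization_hom : gdsHom DW D :=
  GdsHom homog_symmetrization symmetrization_dif symmetrization_contr
    symmetrization_lie.

Lemma sym_part_one k : sym_part k 1 = (k == 0%N)%:R%:A.
Proof.
case: k => [|k]; first by rewrite sym_part0 augmentation1.
by rewrite sym_partS big1 ?scale0r // => a _; rewrite partial1 linear0 mulr0.
Qed.

Lemma symmetrization1 : symmetrization 1 = 1.
Proof.
rewrite (@symmetrizationE 1) => [|[|k] // _]; last by rewrite sym_part_one scale0r.
by rewrite big_ord1 sym_part_one invr1 !scale1r.
Qed.

End SymmetrizationMap.

(** * The permutation sum on words *)

Lemma sum_perm_lift (V : zmodType) n (f : 'S_n.+1 -> V) :
  \sum_t f t = \sum_j \sum_(s : 'S_n) f (lift_perm ord0 j s).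
Proof.
rewrite (partition_big (fun t : 'S_n.+1 => t ord0) predT) //=.
apply: eq_bigr => j _; rewrite (reindex (lift_perm ord0 j)); last first.
  (* [ulsf i s] is the permutation induced by [s] after removing [i] and [s i]; the default of
     [odflt] is never reached. *)
  pose ulsf i (s : 'S_n.+1) k := odflt k (unlift (s i) (s (lift i k))).
  have ulsfK i (s : 'S_n.+1) k : lift (s i) (ulsf i s k) = s (lift i k).
    rewrite /ulsf; have := neq_lift i k.
    by rewrite -(can_eq (permK s)) => /unlift_some[] ? ? ->.
  have inj_ulsf : injective (ulsf ord0 _).
    move=> s x y /(congr1 (lift (s ord0))); rewrite !ulsfK.
    by move/perm_inj/lift_inj.
  exists (fun s => perm (inj_ulsf s)) => [s _ | s].
    by apply/permP => k; rewrite permE /ulsf lift_perm_lift lift_perm_id liftK.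
  rewrite inE => /eqP s0; apply/permP => k.
  case: (unliftP ord0 k) => [k'|] ->; rewrite ?lift_perm_id //.
  by rewrite lift_perm_lift -s0 permE ulsfK.
by apply: eq_bigl => s; rewrite lift_perm_id eqxx.
Qed.

Lemma sum_perm_inv (V : zmodType) n (f : 'S_n -> V) :
  \sum_s f s = \sum_(s : 'S_n) f (s^-1)%g.
Proof.
pose h (s : 'S_n) : 'S_n := (s^-1)%g.
by rewrite (reindex_inj (h := h)) //; apply: invg_inj.
Qed.

Section WordFormula.
Variables (F : fieldType) (g : lieAlgebra F).
Implicit Type k n : nat.

(** The exponent of the sign for moving an odd [v j] to the front: [lift j x] is [x] for [x < j], so
    the odd factors preceding [j] are counted. *)
Definition odd_before n (v : 'I_n.+1 -> bool * dual g) (j : 'I_n.+1) : nat :=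
  \sum_(x < n) ((v (lift j x)).1 && (x < j)%N).

Lemma odd_before0 n (v : 'I_n.+1 -> bool * dual g) : odd_before v ord0 = 0%N.
Proof. by rewrite /odd_before big1 // => x _; rewrite ltn0 andbF. Qed.

Lemma lift_lift0 n (j : 'I_n.+1) (i : 'I_n) :
  lift (lift ord0 j) (lift ord0 i) = lift ord0 (lift j i).
Proof. by apply: val_inj; rewrite /= /bump /= !add1n ltnS; case: leqP. Qed.

Lemma odd_before_lift0 n (v : 'I_n.+2 -> bool * dual g) (j : 'I_n.+1) :
  odd_before v (lift ord0 j) = ((v ord0).1 + odd_before (v \o lift ord0) j)%N.
Proof.
rewrite /odd_before big_ord_recl /=; congr (nat_of_bool _ + _)%N.
  by rewrite andbT; congr (v _).1; apply: val_inj.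
by apply: eq_bigr => x _; rewrite lift_lift0.
Qed.

Lemma inversionsE n (v : 'I_n -> bool * dual g) (t : 'S_n) :
  inversions v (t^-1)%g =
  (\sum_(i < n) \sum_(j < n)
    [&& i < j, (v (t i)).1, (v (t j)).1 & t j < t i])%N.
Proof.
rewrite /inversions invgK pair_bigA /= -sum1_card big_mkcond /=.
by apply: eq_bigr => p _; rewrite inE.
Qed.

(** Inversions involving the first place, which receives [j], are counted by [odd_before]; the
    others are those of [s] on the remaining factors. *)
Lemma inversions_lift_perm n (v : 'I_n.+1 -> bool * dual g) j (s : 'S_n) :
  inversions v ((lift_perm ord0 j s)^-1)%g =
  ((v j).1 * odd_before v j + inversions (v \o lift j) (s^-1)%g)%N.
Proof.
rewrite !inversionsE big_ord_recl /=; congr (_ + _)%N.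
  rewrite big_ord_recl /= add0n /odd_before.
  rewrite [in RHS](reindex_inj (@perm_inj _ s)) big_distrr /=.
  apply: eq_bigr => x _; rewrite lift_perm_id lift_perm_lift /= mulnb.
  congr (nat_of_bool [&& _, _ & _]); rewrite /bump; case: (leqP j (s x)) => //=.
    by rewrite add1n => jx; apply/negbTE; rewrite -leqNgt leqW.
apply: eq_bigr => i _; rewrite big_ord_recl /= add0n.
apply: eq_bigr => x _; rewrite !lift_perm_lift /= !ltnNge !leq_bump2.
by rewrite negbK.
Qed.

Variables (W : weilAlgebra g).

Lemma partial_prod_generator a n (v : 'I_n.+1 -> bool * dual g) :
  partial W a (\prod_(i < n.+1) generator W (v i)) =
  \sum_j (letter_coef (v j) a * (-1) ^+ ((v j).1 * odd_before v j)) *: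
    \prod_(i < n) generator W (v (lift j i)).
Proof.
elim: n v => [|n IHn] v; rewrite big_ord_recl partial_generatorM.
  rewrite big_ord0 partial1 mulr0 scaler0 addr0 big_ord1 big_ord0.
  by rewrite odd_before0 muln0 mulr1.
rewrite (IHn (v \o lift ord0)) [RHS]big_ord_recl odd_before0 muln0 mulr1.
congr (_ + _); rewrite mulr_sumr scaler_sumr; apply: eq_bigr => j _ /=.
rewrite odd_before_lift0 [in RHS]big_ord_recl -scalerAr scalerA mulrCA.
have -> : lift (lift ord0 j) ord0 = ord0 :> 'I_n.+2 by apply: val_inj.
under [in RHS]eq_bigr do rewrite lift_lift0.
congr (_ *: _); rewrite /letter_coef.
(* The signs agree only if [a] has the parity of the differentiated factor; otherwise its
   coefficient is zero. *)
have [<-|_] := eqVneq; last by rewrite !mul0r.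
by congr (_ * _); rewrite mulnDr mulnb exprD.
Qed.

Variables (A : algType F) (D : gdAlgebra g A) (theta : connection D).

Definition signed_perm_sum n (v : 'I_n -> bool * dual g) : A :=
  \sum_(s : 'S_n)
    (-1) ^+ inversions v s *: \prod_(i < n) phi theta (v ((s^-1)%g i)).

(** Sorting the permutations by the factor they put first gives the recursion that [sym_part]
    satisfies on words. *)
Lemma signed_perm_sumS n (v : 'I_n.+1 -> bool * dual g) :
  signed_perm_sum v = \sum_j (-1) ^+ ((v j).1 * odd_before v j) *:
    (phi theta (v j) * signed_perm_sum (v \o lift j)).
Proof.
rewrite /signed_perm_sum sum_perm_inv.
under eq_bigr do rewrite invgK.
rewrite (sum_perm_lift (fun t => (-1) ^+ inversions v t^-1%g *: \prod_i phi theta (v (t i)))).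
apply: eq_bigr => j _; rewrite [in RHS]sum_perm_inv.
rewrite mulr_sumr scaler_sumr; apply: eq_bigr => s _.
rewrite inversions_lift_perm invgK exprD big_ord_recl lift_perm_id -scalerAr scalerA.
by congr (_ *: (_ * _)); apply: eq_bigr => i _; rewrite lift_perm_lift.
Qed.

Lemma sym_part_prod_generator k n (v : 'I_n -> bool * dual g) :
  sym_part theta k (\prod_(i < n) generator W (v i)) =
  (k == n)%:R *: signed_perm_sum v.
Proof.
elim: k n v => [|k IHk] [|n] v.
- rewrite big_ord0 sym_part_one eqxx !scale1r /signed_perm_sum.
  rewrite (big_pred1 (1%g : 'S_0)) => [|s]; last by apply/esym/eqP/permP => -[m].
  rewrite -[(1%g : 'S_0)]invgK inversionsE !big_ord0.
  by rewrite expr0 scale1r.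
- by rewrite sym_part0 big_ord_recl augmentation_generator !scale0r.
- by rewrite big_ord0 sym_part_one !scale0r.
rewrite sym_partS eqSS signed_perm_sumS.
under eq_bigr => a _ do rewrite partial_prod_generator linear_sum mulr_sumr.
rewrite exchange_big scaler_sumr; apply: eq_bigr => j _ /=.
under eq_bigr => a _ do rewrite linearZ /= (IHk n (v \o lift j)) -!scalerAr.
set X := signed_perm_sum _; rewrite phiE mulr_suml !scaler_sumr.
apply: eq_bigr => a _; rewrite -scalerAl !scalerA; congr (_ *: _).
by rewrite mulrC [letter_coef _ _ * _]mulrC mulrA.
Qed.

End WordFormula.

Section Characterization.
Variables (F : fieldType) (charF0 : [pchar F] =i pred0).
Variables (g : lieAlgebra F) (W : weilAlgebra g).
Variables (A : algType F) (D : gdAlgebra g A) (theta : connection D).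

Lemma symmetrizationP : is_symmetrization theta (symmetrization (W := W) theta).
Proof.
move=> n v; rewrite (@symmetrizationE _ _ _ _ _ _ n.+1); last first.
  by move=> k nk; rewrite sym_part_prod_generator gtn_eqF // scale0r.
rewrite big_ord_recr /= big1 => [|k _]; rewrite sym_part_prod_generator.
  by rewrite eqxx scale1r add0r.
by rewrite ltn_eqF // scale0r scaler0.
Qed.

Lemma word_prod_generator s :
  word W s = \prod_(i < size s) generator W (letter_val (tnth (in_tuple s) i)).
Proof. exact: big_tnth. Qed.

Lemma symmetrization_unique (c : {linear W -> A}) :
  is_symmetrization theta c -> c =1 symmetrization (W := W) theta.
Proof.
move=> hc; apply: (weil_linear_eq (h := symmetrization (W := W) theta)) => s.
by rewrite word_prod_generator hc /= symmetrizationP.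
Qed.

End Characterization.

(** * The homotopy on W (x) W *)

Section NumberPolynomials.
Variables (F : fieldType) (M : lmodType F) (N : {linear M -> M}).

(* [m - N (homotopy_poly k m)] is the product of the [1 - N / j] for *)
(* [1 <= j <= k], the projection onto [ker N] when [N] has eigenvalues at *)
(* most [k].                                                             *)
Fixpoint homotopy_poly (k : nat) (m : M) : M :=
  if k is j.+1 then
    homotopy_poly j m + j.+1%:R^-1 *: (m - N (homotopy_poly j m))
  else 0.

Definition kernel_poly k m := m - N (homotopy_poly k m).

Lemma kernel_poly0 m : kernel_poly 0 m = m.
Proof. by rewrite /kernel_poly linear0 subr0. Qed.

Lemma kernel_polyS k m :
  kernel_poly k.+1 m = kernel_poly k m - k.+1%:R^-1 *: N (kernel_poly k m).
Proof. by rewrite /kernel_poly /= linearD linearZ /= opprD addrA. Qed.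

Lemma homotopy_poly_comm (O : {linear M -> M}) k m :
  (forall x, O (N x) = N (O x)) -> O (homotopy_poly k m) = homotopy_poly k (O m).
Proof.
move=> ON; elim: k => [|k IHk] /=; first exact: linear0.
by rewrite linearD linearZ linearB /= ON IHk.
Qed.

Lemma kernel_poly_comm (O : {linear M -> M}) k m :
  (forall x, O (N x) = N (O x)) -> O (kernel_poly k m) = kernel_poly k (O m).
Proof. by move=> ON; rewrite /kernel_poly linearB /= ON homotopy_poly_comm. Qed.

Lemma homotopy_polyB k x y :
  homotopy_poly k (x - y) = homotopy_poly k x - homotopy_poly k y.
Proof.
elim: k => [|k IHk] /=; first by rewrite subr0.
rewrite IHk [- (homotopy_poly k y + _)]opprD [RHS]addrACA; congr (_ + _).
rewrite -scalerBr; congr (_ *: _).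
by rewrite linearB [in LHS]opprD [in RHS]opprD addrACA.
Qed.

(** As [H N = (N + 1) H], moving [H] inward turns each [1 - N / j] into [(j - 1 - N) / j]. The
    factor at [j = 1] becomes [- N], and the others are rescaled factors of [kernel_poly k], with
    scalars multiplying to [1 / (k + 1)]. *)
Lemma kernel_poly_shift (charF0 : [pchar F] =i pred0) (H : {linear M -> M}) k m :
    (forall x, H (N x) = N (H x) + H x) ->
  H (kernel_poly k.+1 m) = - (k.+1%:R^-1 *: N (kernel_poly k (H m))).
Proof.
move=> HN; elim: k => [|k IHk].
  rewrite kernel_polyS !kernel_poly0 invr1 !scale1r linearB /=.
  by rewrite HN opprD addrCA subrr addr0.
rewrite kernel_polyS linearB linearZ /= HN IHk.
set R := kernel_poly k (H m); rewrite [kernel_poly k.+1 (H m)]kernel_polyS -/R.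
set c := k.+1%:R^-1; set d := k.+2%:R^-1; set X := N R.
have -> : N (- (c *: X)) = - (c *: N X) by rewrite linearN linearZ.
have -> : N (R - c *: X) = X - c *: N X by rewrite linearB linearZ.
rewrite -[- (c *: N X) - _]opprD scalerN opprK scalerDr.
rewrite scalerBr opprB addrCA; congr (_ + _).
rewrite scalerA -!scaleNr -scalerDl; congr (_ *: _).
have k1 : k.+1%:R != 0 :> F by apply: pchar0_natf_neq0.
have k2 : k.+2%:R != 0 :> F by apply: pchar0_natf_neq0.
have d1 : 1 - d = k.+1%:R * d.
  by rewrite -{1}(divff k2) -/d -[X in _ - X]mul1r -mulrBl -natr1 addrK.
by rewrite addrC -opprB -{1}[c]mul1r -mulrBl d1 mulrAC divff ?mul1r.
Qed.

End NumberPolynomials.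

(** * Bilinear maps in place of linear maps on W (x) W *)

Section Pairings.
Variables (F : fieldType) (W V : lmodType F).

(* Bilinear maps stand for linear maps on W (x) W, on which the operators of *)
(* W (x) W act by transposition.                                             *)
Record pairing := Pairing {
  pair_fun :> W -> W -> V;
  pair_linear_l : forall v, linear (fun u => pair_fun u v);
  pair_linear_r : forall u, linear (pair_fun u)
}.

Lemma pairing_eq (m m' : pairing) : m =2 m' -> m = m'.
Proof.
case: m m' => [f fl fr] [h hl hr] /= fh.
have {}fh : f = h by apply/funext => u; apply/funext => v; apply: fh.
by subst h; congr Pairing; apply: Prop_irrelevance.
Qed.

HB.instance Definition _ (m : pairing) u :=
  GRing.isLinear.Build F W V _ (m u) (pair_linear_r m u).

Definition pair_l (m : pairing) v u := m u v.
HB.instance Definition _ (m : pairing) v :=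
  GRing.isLinear.Build F W V _ (pair_l m v) (pair_linear_l m v).

Lemma pairDl (m : pairing) u u' v : m (u + u') v = m u v + m u' v.
Proof. exact: (linearD (pair_l m v)). Qed.
Lemma pairNl (m : pairing) u v : m (- u) v = - m u v.
Proof. exact: (linearN (pair_l m v)). Qed.
Lemma pairZl (m : pairing) a u v : m (a *: u) v = a *: m u v.
Proof. exact: (linearZ_LR (pair_l m v)). Qed.
Lemma pair0l (m : pairing) v : m 0 v = 0.
Proof. exact: (linear0 (pair_l m v)). Qed.
Lemma pair_suml (m : pairing) (I : finType) (f : I -> W) v :
  m (\sum_i f i) v = \sum_i m (f i) v.
Proof. exact: (linear_sum (pair_l m v)). Qed.

Lemma pairDr (m : pairing) u v v' : m u (v + v') = m u v + m u v'.
Proof. exact: linearD. Qed.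
Lemma pairNr (m : pairing) u v : m u (- v) = - m u v.
Proof. exact: linearN. Qed.
Lemma pairZr (m : pairing) a u v : m u (a *: v) = a *: m u v.
Proof. exact: linearZ_LR. Qed.
Lemma pair0r (m : pairing) u : m u 0 = 0.
Proof. exact: linear0. Qed.
Lemma pair_sumr (m : pairing) (I : finType) (f : I -> W) u :
  m u (\sum_i f i) = \sum_i m u (f i).
Proof. exact: linear_sum. Qed.

HB.instance Definition _ := gen_eqMixin pairing.
HB.instance Definition _ := gen_choiceMixin pairing.

Definition pairing_lincomb (a b : F) (m m' : pairing) : pairing.
Proof.
apply: (@Pairing (fun u v => a *: m u v + b *: m' u v)) => w c x y.
  by rewrite !pairDl !pairZl !scalerDr addrACA !scalerA ![c * _]mulrC.
by rewrite !pairDr !pairZr !scalerDr addrACA !scalerA ![c * _]mulrC.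
Defined.

Definition pairing0 : pairing.
Proof. by apply: (@Pairing (fun _ _ => 0)) => w c x y; rewrite scaler0 addr0. Defined.

Definition pairing_add := pairing_lincomb 1 1.
Definition pairing_opp m := pairing_lincomb (-1) 0 m pairing0.
Definition pairing_scale a m := pairing_lincomb a 0 m pairing0.

Lemma pairing_addE m m' u v : pairing_add m m' u v = m u v + m' u v.
Proof. by rewrite /= !scale1r. Qed.
Lemma pairing_oppE m u v : pairing_opp m u v = - m u v.
Proof. by rewrite /= scaler0 addr0 scaleN1r. Qed.
Lemma pairing_scaleE a m u v : pairing_scale a m u v = a *: m u v.
Proof. by rewrite /= scaler0 addr0. Qed.

Fact pairing_addA : associative pairing_add.
Proof. by move=> x y z; apply: pairing_eq => u v; rewrite !pairing_addE addrA. Qed.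
Fact pairing_addC : commutative pairing_add.
Proof. by move=> x y; apply: pairing_eq => u v; rewrite !pairing_addE addrC. Qed.
Fact pairing_add0 : left_id pairing0 pairing_add.
Proof. by move=> x; apply: pairing_eq => u v; rewrite pairing_addE add0r. Qed.
Fact pairing_addN : left_inverse pairing0 pairing_opp pairing_add.
Proof.
by move=> x; apply: pairing_eq => u v; rewrite pairing_addE pairing_oppE addNr.
Qed.
HB.instance Definition _ := GRing.isZmodule.Build pairing
  pairing_addA pairing_addC pairing_add0 pairing_addN.

Fact pairing_scaleA a b m :
  pairing_scale a (pairing_scale b m) = pairing_scale (a * b) m.
Proof. by apply: pairing_eq => u v; rewrite !pairing_scaleE scalerA. Qed.
Fact pairing_scale1 : left_id 1 pairing_scale.
Proof. by move=> x; apply: pairing_eq => u v; rewrite pairing_scaleE scale1r. Qed.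
Fact pairing_scaleDr : right_distributive pairing_scale +%R.
Proof.
move=> a x y; apply: pairing_eq => u v.
by rewrite pairing_scaleE !pairing_addE !pairing_scaleE scalerDr.
Qed.
Fact pairing_scaleDl m : {morph pairing_scale^~ m : a b / a + b}.
Proof.
move=> a b; apply: pairing_eq => u v.
by rewrite pairing_addE !pairing_scaleE scalerDl.
Qed.
HB.instance Definition _ := GRing.Zmodule_isLmodule.Build F pairing
  pairing_scaleA pairing_scale1 pairing_scaleDr pairing_scaleDl.

Lemma pairD (m m' : pairing) u v : (m + m') u v = m u v + m' u v.
Proof. exact: pairing_addE. Qed.
Lemma pairN (m : pairing) u v : (- m) u v = - m u v.
Proof. exact: pairing_oppE. Qed.
Lemma pairB (m m' : pairing) u v : (m - m') u v = m u v - m' u v.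
Proof. by rewrite pairD pairN. Qed.
Lemma pairZ a (m : pairing) u v : (a *: m) u v = a *: m u v.
Proof. exact: pairing_scaleE. Qed.
Lemma pair_sum (I : finType) (m : I -> pairing) u v :
  (\sum_i m i) u v = \sum_i m i u v.
Proof.
exact: (big_morph (fun m' : pairing => m' u v) (fun x y => pairD x y u v) erefl).
Qed.

Definition pair_op (P Q : {linear W -> W}) (m : pairing) : pairing.
Proof.
apply: (@Pairing (fun u v => m (P u) (Q v))) => w c x y.
  by rewrite linearP pairDl pairZl.
by rewrite linearP pairDr pairZr.
Defined.

Lemma pair_opE P Q m u v : pair_op P Q m u v = m (P u) (Q v).
Proof. by []. Qed.

Fact pair_op_linear P Q : linear (pair_op P Q).
Proof.
move=> a m m'; apply: pairing_eq => u v.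
by rewrite pairD pairZ !pair_opE pairD pairZ.
Qed.
HB.instance Definition _ P Q :=
  GRing.isLinear.Build F pairing pairing _ (pair_op P Q) (pair_op_linear P Q).

Definition pair_post (f : {linear V -> V}) (m : pairing) : pairing.
Proof.
apply: (@Pairing (fun u v => f (m u v))) => w c x y.
  by rewrite pairDl pairZl linearP.
by rewrite pairDr pairZr linearP.
Defined.

Lemma pair_postE f m u v : pair_post f m u v = f (m u v).
Proof. by []. Qed.

Fact pair_post_linear f : linear (pair_post f).
Proof.
move=> a m m'; apply: pairing_eq => u v.
by rewrite pairD pairZ !pair_postE pairD pairZ linearP.
Qed.
HB.instance Definition _ f :=
  GRing.isLinear.Build F pairing pairing _ (pair_post f) (pair_post_linear f).

End Pairings.

Section Transgression.
Variables (F : fieldType) (charF0 : [pchar F] =i pred0).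
Variables (g : lieAlgebra F) (W : weilAlgebra g) (V : lmodType F).
Local Notation D := (weil_gda W).
Local Notation WS := (gda_super D).
Local Notation sg := (ginv D true).
Local Notation pairing := (pairing W V).
Implicit Type m : pairing.

(* The transposes of the derivation [T] of W (x) W, of the derivation mapping  *)
(* 1 (x) ev to 1 (x) od - od (x) 1 and killing od (x) 1, ev (x) 1, 1 (x) od,    *)
(* and of the derivation mapping 1 (x) x to 1 (x) x - x (x) 1 for all letters x *)
(* and killing W (x) 1.                                                         *)
Definition pair_der (T : {linear W -> W}) m : pairing :=
  pair_op T idfun m + pair_op sg T m.

Definition koszul m : pairing :=
  \sum_i (pair_op sg (lgen W (true, i) \*o partial W (false, i)) m
    - pair_op (lgen W (true, i) \o* sg) (partial W (false, i)) m).

Definition number m : pairing :=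
  pair_op idfun (@euler _ _ W) m - \sum_a pair_op (lgen W a \o* idfun) (partial W a) m.

(* The transpose of left multiplication by 1 (x) x_b - x_b (x) 1. *)
Definition shift b m : pairing :=
  pair_op (ginv D b.1) (lgen W b \*o idfun) m - pair_op (lgen W b \*o idfun) idfun m.

Lemma pair_derE T m u v : pair_der T m u v = m (T u) v + m (sg u) (T v).
Proof. by rewrite pairD. Qed.

Lemma koszulE m u v : koszul m u v =
  \sum_i (m (sg u) (lgen W (true, i) * partial W (false, i) v)
    - m (sg u * lgen W (true, i)) (partial W (false, i) v)).
Proof. by rewrite pair_sum; apply: eq_bigr => i _; rewrite pairB. Qed.

Lemma numberE m u v :
  number m u v = m u (euler v) - \sum_a m (u * lgen W a) (partial W a v).
Proof. by rewrite pairB pair_sum. Qed.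

Lemma shiftE b m u v :
  shift b m u v = m (ginv D b.1 u) (lgen W b * v) - m (lgen W b * u) v.
Proof. by rewrite pairB. Qed.

Fact pair_der_linear T : linear (pair_der T).
Proof.
move=> a m m'; apply: pairing_eq => u v.
by rewrite [RHS]pairD [X in _ = X + _]pairZ !pair_derE !pairD !pairZ scalerDr addrACA.
Qed.
HB.instance Definition _ T :=
  GRing.isLinear.Build F pairing pairing _ (pair_der T) (pair_der_linear T).

Fact koszul_linear : linear koszul.
Proof.
move=> a m m'; apply: pairing_eq => u v.
rewrite [RHS]pairD [X in _ = X + _]pairZ !koszulE scaler_sumr -big_split; apply: eq_bigr => i _.
by rewrite !pairD !pairZ scalerBr opprD addrACA.
Qed.
HB.instance Definition _ :=
  GRing.isLinear.Build F pairing pairing _ koszul koszul_linear.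

Fact number_linear : linear number.
Proof.
move=> a m m'; apply: pairing_eq => u v.
rewrite [RHS]pairD [X in _ = X + _]pairZ !numberE pairD pairZ.
under eq_bigr do rewrite pairD pairZ.
by rewrite big_split -scaler_sumr scalerBr opprD addrACA.
Qed.
HB.instance Definition _ :=
  GRing.isLinear.Build F pairing pairing _ number number_linear.

Fact shift_linear b : linear (shift b).
Proof.
move=> a m m'; apply: pairing_eq => u v.
by rewrite [RHS]pairD [X in _ = X + _]pairZ !shiftE !pairD !pairZ scalerBr opprD addrACA.
Qed.
HB.instance Definition _ b :=
  GRing.isLinear.Build F pairing pairing _ (shift b) (shift_linear b).

(** Multiplication by a difference [1 (x) x_b - x_b (x) 1] raises the degree counted by [number] by
    one; transposition reverses the order of composition. *)
Lemma shift_number b m : shift b (number m) = number (shift b m) + shift b m.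
Proof.
apply: pairing_eq => u v; rewrite [RHS]pairD shiftE !numberE !shiftE.
have -> : euler (lgen W b * v) = lgen W b * v + lgen W b * euler v.
  by rewrite (euler_derivation _ (homog_lgen W b)) euler_lgen scale1r.
have -> : \sum_a m (ginv D b.1 u * lgen W a) (partial W a (lgen W b * v)) =
    m (lgen W b * u) v +
    \sum_a m (ginv D b.1 (u * lgen W a)) (lgen W b * partial W a v).
  rewrite (@super_commE _ _ D _ _ u (@weil_super_commutative _ _ W) (homog_lgen W b)).
  have -> : m (ginv D b.1 u * lgen W b) v =
      \sum_a (b == a)%:R *: m (ginv D b.1 u * lgen W a) v.
    rewrite (bigD1 b) //= eqxx scale1r big1 ?addr0 // => a ab.
    by rewrite eq_sym (negPf ab) scale0r.
  rewrite -big_split; apply: eq_bigr => a _ /=.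
  rewrite partial_lgenM pairDr !pairZr (ginvM WS) (ginv_homog _ (homog_lgen W a)).
  by rewrite -scalerAr pairZl andbC.
under [X in _ = _ - X + _]eq_bigr => a _ do rewrite shiftE mulrA.
rewrite sumrB pairDr.
set A := m _ _; set B := m _ _; set C := m _ v; set P := \sum_a _.
set Q := m _ (euler v); set R := \sum_a _.
rewrite !opprD !opprK !addrA.
by rewrite [LHS](ACl (2*5*4*6*1*3)).
Qed.

Section AntiCommutator.
Variables (T : {linear W -> W}) (c : letter g -> F).
Variables (v : letter g -> bool * dual g).
Hypothesis gdT : generator_derivation true T c v.

Let T_sg u : T (sg u) = - sg (T u).
Proof. by rewrite (ginv_op _ _ (gd_parity gdT)) expr1 scaleN1r opprK. Qed.

(** On a difference [1 (x) x - x (x) 1] the constant of [T] cancels and a difference remains, so [T]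
    preserves the degree in differences. *)
Lemma number_der m : number (pair_der T m) = pair_der T (number m).
Proof.
apply: pairing_eq => u w; rewrite numberE !pair_derE !numberE.
rewrite (euler_derivation_comm gdT) pairDr.
under eq_bigr => a _ do rewrite pair_derE.
rewrite big_split /=.
have -> : \sum_a m (sg u * lgen W a) (partial W a (T w)) =
    \sum_a m (sg (u * lgen W a)) (T (partial W a w)) +
    \sum_a m (sg u * generator W (v a)) (partial W a w).
  under eq_bigr => b _ do rewrite (partial_derivation_comm gdT) pairDr pair_sumr.
  rewrite big_split exchange_big /=; congr (_ + _); apply: eq_bigr => a _.
    rewrite (ginvM WS) (ginv_homog _ (homog_lgen W a)) -scalerAr pairZl.
    by rewrite pairZr.
  rewrite generatorE mulr_sumr pair_suml; apply: eq_bigr => b _.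
  by rewrite pairZr -scalerAr pairZl.
have -> : \sum_a m (T (u * lgen W a)) (partial W a w) =
    \sum_a m (T u * lgen W a) (partial W a w) +
    (m (sg u) (const_part c w) +
     \sum_a m (sg u * generator W (v a)) (partial W a w)).
  rewrite /const_part pair_sumr -!big_split; apply: eq_bigr => a _ /=.
  rewrite (sderE _ _ (gd_derivation gdT)) (gd_lgen gdT) pairDl; congr (_ + _).
  by rewrite mulrDr pairDl -scalerAr mulr1 pairZl pairZr.
set A := m _ _; set B := m _ _; set C := m _ _; set P := \sum_a _.
set Q := \sum_a _; set R := \sum_a _.
rewrite !opprD !addrA.
by rewrite [LHS](ACl (3*5*(1*4*2*7*6))) /= subrr add0r.
Qed.

(** The anticommutator is a derivation of W (x) W. Its value on [1 (x) ev] contains [T] of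
    [1 (x) od - od (x) 1], where constants cancel; the inner sum is the Koszul derivation applied to
    the even letters occurring in [T]. *)
Lemma koszul_der m u w :
  koszul (pair_der T m) u w + pair_der T (koszul m) u w =
  \sum_i (m u (generator W (v (true, i)) * partial W (false, i) w)
    - m (u * generator W (v (true, i))) (partial W (false, i) w)
    + \sum_a letter_coef (v a) (false, i) *:
        (m u (lgen W (true, i) * partial W a w)
         - m (u * lgen W (true, i)) (partial W a w))).
Proof.
rewrite pair_derE !koszulE -!big_split; apply: eq_bigr => i _.
set o := lgen W (true, i); set y := partial W (false, i) w.
set x := generator W _; set k := c (true, i).
have sgo : sg o = - o by rewrite (ginv_homog _ (homog_lgen W _)) expr1 scaleN1r.
have To : T o = k%:A + x by rewrite (gd_lgen gdT).
have To_y z : T (o * z) = k *: z + x * z - o * T z.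
  by rewrite (sderE _ _ (gd_derivation gdT)) To sgo mulrDl mulr_algl mulNr.
have dTw : partial W (false, i) (T w) =
    T y + \sum_a letter_coef (v a) (false, i) *: partial W a w.
  by rewrite (partial_derivation_comm gdT) /= scale1r.
set z := \sum_a _ in dTw.
have -> : \sum_a letter_coef (v a) (false, i) *:
    (m u (o * partial W a w) - m (u * o) (partial W a w)) =
    m u (o * z) - m (u * o) z.
  rewrite /z mulr_sumr !pair_sumr -sumrB; apply: eq_bigr => a _.
  by rewrite -scalerAr !pairZr scalerBr.
rewrite !pair_derE To_y dTw (sderE _ _ (gd_derivation gdT)) To !(ginvM WS) !ginvK sgo.
rewrite !T_sg !(mulrN, mulNr, mulrDr, mulrDl) -!scalerAr mulr1.
rewrite !(pairDl, pairDr, pairNl, pairNr, pairZl, pairZr).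
rewrite /= !opprD !opprK !addrA.
rewrite [LHS](ACl ((9*1)*(2*6)*(11*4)*(5*10)*(8*13)*(3*7*12*14))) /=.
by rewrite !subrr !add0r.
Qed.

End AntiCommutator.

Lemma sum_letters (f : letter g -> V) :
  \sum_a f a = \sum_i (f (false, i) + f (true, i)).
Proof.
transitivity (\sum_p \sum_i f (p, i)); first by rewrite pair_bigA; apply: eq_bigr => -[].
by rewrite exchange_big; apply: eq_bigr => i _; rewrite big_bool addrC.
Qed.

Lemma koszul_dif m :
  koszul (pair_der (dif D) m) + pair_der (dif D) (koszul m) = number m.
Proof.
apply: pairing_eq => u w; rewrite [LHS]pairD (koszul_der (weil_dif_gd W)).
rewrite numberE /euler pair_sumr -sumrB sum_letters; apply: eq_bigr => i _.
congr (_ + _); rewrite (bigD1 (true, i)) //= big1 => [|[[] j] ji].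
- by rewrite (letter_coef_val (false, i)) eqxx scale1r addr0.
- rewrite (letter_coef_val (false, j)) [(_, j) == _]xpair_eqE /=.
  have -> : (j == i) = false by apply/negbTE; apply: contra ji => /eqP ->.
  by rewrite scale0r.
by rewrite /letter_coef /= mul0r scale0r.
Qed.

(** Both contributions in [koszul_der] vanish: contractions send odd letters to scalars and produce
    no even letters. *)
Lemma koszul_contr xi m :
  koszul (pair_der (contr D xi) m) = - pair_der (contr D xi) (koszul m).
Proof.
apply/eqP; rewrite -addr_eq0; apply/eqP/pairing_eq => u w.
rewrite [LHS]pairD (koszul_der (weil_contr_gd W xi)) big1 // => i _.
rewrite /generator /= linear0 mul0r mulr0 pair0l pair0r subr0 add0r.
apply: big1 => -[[] j] _; rewrite /letter_coef /= ?mul0r ?scale0r //.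
by rewrite zero_lfunE mulr0 scale0r.
Qed.

Lemma number1 m u : number m u 1 = 0.
Proof.
rewrite numberE euler1 pair0r big1 ?subr0 // => a _.
by rewrite partial1 pair0r.
Qed.

Local Notation N := (number : {linear pairing -> pairing}).

(** The first letter is moved to the left slot. By [kernel_poly_shift] the error is a multiple of
    [N] of a kernel polynomial at the shorter word, which by induction is a value of [number] at 1,
    hence zero. *)
Lemma kernel_poly_word k m u s : (size s <= k)%N ->
  kernel_poly N k m u (word W s) = m (u * word W s) 1.
Proof.
elim: s k m u => [|b s IHs] [|k] m u // sk.
- by rewrite kernel_poly0 /word big_nil mulr1.
- by rewrite /word big_nil mulr1 pairB number1 subr0.
have [u' ->] : exists u', u = ginv D b.1 u' by exists (ginv D b.1 u); rewrite ginvK.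
rewrite word_cons mulrA -(@super_commE _ _ D _ _ u' (@weil_super_commutative _ _ W) (homog_lgen W b)).
have := shiftE b (kernel_poly N k.+1 m) u' (word W s).
rewrite (IHs k.+1) ?leqW // => /eqP; rewrite eq_sym subr_eq => /eqP ->.
rewrite (@kernel_poly_shift _ _ N charF0 (shift b) _ _ (shift_number b)) pairN pairZ.
by rewrite (@kernel_poly_comm _ _ N N) // (IHs k) // number1 scaler0 oppr0 add0r.
Qed.

Lemma kernel_poly_exists q : exists k, forall m u,
  kernel_poly N k m u q = m (u * q) 1.
Proof.
suff [k hk] : exists k, forall l m u, (k <= l)%N ->
    kernel_poly N l m u q = m (u * q) 1 by exists k => m u; apply: hk.
elim/weil_word_ind: q => [a x y [k hk] [l hl]|s].
  exists (maxn k l) => j m u; rewrite geq_max => /andP[kj lj].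
  by rewrite pairDr pairZr hk // hl // mulrDr -scalerAr pairDl pairZl.
by exists (size s) => l m u; apply: kernel_poly_word.
Qed.

End Transgression.

Section PairingCohomology.
Variables (F : fieldType) (charF0 : [pchar F] =i pred0).
Variables (g : lieAlgebra F) (W : weilAlgebra g).
Variables (V : lmodType F) (DV : gdSpace g V).
Local Notation D := (weil_gda W).

(** By [kernel_poly_exists], [m 1 q - m q 1] is [N] applied to a homotopy polynomial of [m],
    evaluated at [1] and [q]. Writing [N] as the anticommutator of [d] and [koszul], the term where
    [d] acts last on the arguments drops out, as [1] and [q] are closed. *)
Lemma pairing_transgression (m : pairing W V) q :
    (forall u v, dif DV (m u v) = pair_der (dif D) m u v) ->
    (forall xi u v, contr DV xi (m u v) = pair_der (contr D xi) m u v) ->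
    basic D q ->
  exists2 y, basic DV y & m 1 q - m q 1 = dif DV y.
Proof.
move=> md mi bq; have [k hk] := kernel_poly_exists charF0 V q.
pose N : {linear pairing W V -> pairing W V} := @number _ _ W V.
pose y := homotopy_poly N k (koszul m) 1 q.
have dq : dif D q = 0 by exact: dif_basic.
have iq xi : contr D xi q = 0 by have [] := bq xi.
have der_q (T : {linear W -> W}) (x : pairing W V) :
    T 1 = 0 -> T q = 0 -> pair_der T x 1 q = 0.
  by move=> T1 Tq; rewrite pair_derE T1 Tq pair0l pair0r addr0.
have post_comm (f : {linear V -> V}) x : pair_post f (N x) = N (pair_post f x).
  apply: pairing_eq => u v; rewrite pair_postE -[N x]/(number x).
  rewrite -[N _]/(number (pair_post f x)) !numberE linearB.
  by congr (_ - _); apply: linear_sum.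
have post_koszul (f : {linear V -> V}) x : pair_post f (koszul x) = koszul (pair_post f x).
  apply: pairing_eq => u v; rewrite pair_postE !koszulE linear_sum.
  by apply: eq_bigr => i _; rewrite linearB.
have f_y (f : {linear V -> V}) : f y = homotopy_poly N k (koszul (pair_post f m)) 1 q.
  by rewrite -post_koszul -(@homotopy_poly_comm _ _ N (pair_post f) _ _ (post_comm f)).
have md' : pair_post (dif DV) m = pair_der (dif D) m by apply: pairing_eq.
have mi' xi : pair_post (contr DV xi) m = pair_der (contr D xi) m.
  by apply: pairing_eq => u v; rewrite -mi.
have mE : m 1 q - m q 1 = dif DV y.
  rewrite f_y md'.
  have -> : koszul (pair_der (dif D) m) = N m - pair_der (dif D) (koszul m).
    by rewrite -[N m]/(number m) -koszul_dif addrK.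
  rewrite homotopy_polyB pairB -(@homotopy_poly_comm _ _ N (pair_der (dif D))).
    rewrite der_q ?subr0 //; last exact: derivation1 (dif_derivation D).
    rewrite -(@homotopy_poly_comm _ _ N N) // -[q in m q 1]mul1r -hk.
    by rewrite pairB opprB addrC subrK.
  by move=> x; apply/esym; apply: (number_der (weil_dif_gd W)).
have iy xi : contr DV xi y = 0.
  rewrite f_y mi' koszul_contr -[- _]add0r homotopy_polyB pairB.
  rewrite -(@homotopy_poly_comm _ _ N (pair_der (contr D xi))).
    rewrite [X in _ - X]der_q //; last exact: derivation1 (contr_derivation D xi).
    have := homotopy_polyB N k 0 0; rewrite !subrr => ->.
    by rewrite subr0.
  by move=> x; apply/esym; apply: (number_der (weil_contr_gd W xi)).
exists y => // xi; split=> //.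
(* By Cartan's formula only the contraction of [d y = m 1 q - m q 1] remains, and it vanishes since
   [1] and [q] are horizontal. *)
rewrite -(dif_contr DV) /scomm iy linear0 -mE linearB /= !mi.
have T1 : contr D xi 1 = 0 := derivation1 (contr_derivation D xi).
rewrite !pair_derE T1 iq !pair0l !pair0r.
by rewrite !addr0 subrr scaler0 subr0.
Qed.

End PairingCohomology.

(** * Basic cohomology *)

Section ProductPairing.
Variables (F : fieldType) (charF0 : [pchar F] =i pred0).
Variables (g : lieAlgebra F) (W : weilAlgebra g).
Variables (A : algType F) (D : gdAlgebra g A).
Local Notation DW := (weil_gda W).

Definition mul_pairing (f h : {linear W -> A}) (p : W) : pairing W A.
Proof.
apply: (@Pairing _ _ _ (fun u v => f (p * u) * h v)) => w c x y.
  by rewrite mulrDr -scalerAr linearP mulrDl scalerAl.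
by rewrite linearP mulrDr scalerAr.
Defined.

Lemma ginv_gdsHom (f : gdsHom DW D) q x : ginv D q (f x) = f (ginv DW q x).
Proof.
elim/(@homog_ind _ _ DW): x => [i x hx|x y ex ey]; last by rewrite !linearD /= ex ey.
by rewrite (ginv_homog q hx) linearZ /= (ginv_homog q (gdsHom_even f hx)).
Qed.

(* Taking [p = 1] compares [f] with [h]; taking [f = h] compares [f (p * q)] *)
(* with [f p * f q].                                                        *)
Lemma gdsHom_basic_mul (f h : gdsHom DW D) p q : basic DW p -> basic DW q ->
  exists2 y, basic D y & f p * h q - f (p * q) * h 1 = dif D y.
Proof.
move=> bp bq; have hp := basic_even charF0 bp.
(* [p] is even and killed by [T], so [T] passes it without a sign and left multiplication by [p] is
   harmless. *)
have der_mul (T : {linear W -> W}) (S : {linear A -> A}) : super_derivation DW true T ->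
    super_derivation D true S -> T p = 0 ->
    (forall x, f (T x) = S (f x)) -> (forall x, h (T x) = S (h x)) ->
  forall u v, S (mul_pairing f h p u v) = pair_der T (mul_pairing f h p) u v.
  move=> dT dS Tp fT hT u v; rewrite pair_derE /= (sderE _ _ dS) -fT -hT.
  rewrite (dT _ _ _ hp) Tp mul0r add0r scale1r ginv_gdsHom.
  by rewrite (ginvM (gda_super DW)) (ginv_homog true hp) scale1r.
have [y by_ yE] := @pairing_transgression _ charF0 _ W A D (mul_pairing f h p) q
  (der_mul (dif DW) (dif D) (dif_derivation DW) (dif_derivation D)
     (dif_basic charF0 bp) (gdsHom_dif f) (gdsHom_dif h))
  (fun xi => der_mul (contr DW xi) (contr D xi) (contr_derivation DW xi)
     (contr_derivation D xi) (bp xi).1 (gdsHom_contr f xi) (gdsHom_contr h xi)) bq.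
by exists y; rewrite // -yE /= mulr1.
Qed.

Lemma Hmap_eq (f h : gdsHom DW D) : f 1 = 1 -> h 1 = 1 -> Hmap f =1 Hmap h.
Proof.
move=> f1 h1 x; rewrite -(HclassK x) !HmapE; apply/esym/Hclass_eqP.
have /basic_closedP[bq _] := valP (repr x).
have b1 : basic DW 1.
  move=> xi; split; first exact: derivation1 (contr_derivation DW xi).
  exact: derivation1 (lie_derivation DW xi).
have [y by_ yE] := gdsHom_basic_mul f h b1 bq.
by exists y; rewrite // -yE f1 h1 !mul1r mulr1.
Qed.

Lemma Hmap_linear (f : gdsHom DW D) : linear (Hmap f).
Proof.
move=> a x y; rewrite -(HclassK x) -(HclassK y).
have cZ z : a *: Hclass z = Hclass (a *: z) :> basicH DW by rewrite HclassZ.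
have cZ' z : a *: Hclass z = Hclass (a *: z) :> basicH D by rewrite HclassZ.
rewrite cZ -raddfD !HmapE cZ' -raddfD; congr Hclass; apply: val_inj.
by rewrite [RHS]linearP /= linearP.
Qed.

Lemma Hmap_monoid_morphism (f : gdsHom DW D) :
  f 1 = 1 -> monoid_morphism (Hmap f).
Proof.
move=> f1; split.
  rewrite [1 in LHS]/(Hclass 1) HmapE; congr Hclass; apply: val_inj.
  by rewrite /= f1.
move=> x y; rewrite -(HclassK x) -(HclassK y).
have M (u v : cocycle DW) : Hclass u * Hclass v = Hclass (u * v) by rewrite HclassM.
have M' (u v : cocycle D) : Hclass u * Hclass v = Hclass (u * v) by rewrite HclassM.
rewrite M !HmapE M'.
apply/esym/Hclass_eqP.
have /basic_closedP[bp _] := valP (repr x); have /basic_closedP[bq _] := valP (repr y).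
have [z bz zE] := gdsHom_basic_mul f f bp bq.
by exists z; rewrite // -zE f1 mulr1.
Qed.

End ProductPairing.

Theorem theoremA (F : fieldType) (charF0 : [pchar F] =i pred0)
    (g : lieAlgebra F) (W : weilAlgebra g)
    (A : algType F) (D : gdAlgebra g A) :
  [/\ forall w : W, basic (weil_gda W) w <-> in_Sg_inv w,
      forall w : W, basic (weil_gda W) w -> dif (weil_gda W) w = 0,
      bijective (@Hclass F g W (weil_gda W)) &
      exists c : connection D -> gdsHom (weil_gda W) D,
        [/\ forall theta, is_symmetrization theta (c theta),
            forall theta (c' : {linear W -> A}),
              is_symmetrization theta c' -> c' =1 c theta,
            forall theta theta', Hmap (c theta) =1 Hmap (c theta') &
            forall theta,
              linear (Hmap (c theta)) /\ monoid_morphism (Hmap (c theta))]].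
Proof.
split=> [w|w||].
- exact: basic_in_Sg_inv.
- exact: dif_basic.
(* As [d] vanishes on basic elements, the only coboundary is zero. *)
- exists repr => x; last exact: HclassK.
  have /Hclass_eqP[y by_ yE] := HclassK (Hclass x).
  apply/eqP; rewrite -subr_eq0; apply/eqP/val_inj.
  by rewrite [LHS]linearB yE (dif_basic charF0 by_) linear0.
exists (symmetrization_hom charF0 W (D := D)).
split=> [theta|theta c'|theta theta'|theta].
- exact: symmetrizationP.
- exact: symmetrization_unique.
- by apply: Hmap_eq => //; apply: symmetrization1.
split; first exact: Hmap_linear.
by apply: Hmap_monoid_morphism => //; apply: symmetrization1.
Qed.
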